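(* Let $\Theta$ be a simplicial theory satisfying $n$-local discriminability for some positive integer $n$. For every pair of systems $A,B\in\mathsf{Sys}(\Theta)$, the state-space $\mathsf{St}(AB)$ is classified by the following: (i) a choice of the dimension $D_{AB}$ of the composite system; (ii) an unambiguous labeling of the pure states of $AB$ as $|(ij)_k)_{AB}$, for $i\in\{1,\dots,D_A\}$, $j\in\{1,\dots,D_B\}$ and $k$ in finite sets $I_{ij}$, and a choice of probability distributions $p^{ij}_k$, such that $$|i)_A|j)_B=\sum_{k\in I_{ij}}p^{ij}_k\,|(ij)_k)_{AB},$$ with $p^{ij}_k>0$ and $\sum_{k\in I_{ij}}p^{ij}_k=1$, for all non-null extremal states $|i)_A\in\mathsf{ExtSt}(A)$, $|j)_B\in\mathsf{ExtSt}(B)$.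
   Context: **Operational probabilistic theories (OPTs).** An OPT $\Theta$ consists of a class $\mathsf{Sys}(\Theta)$ of systems $A,B,\dots$ with a trivial system $I$ and an associative composition $(A,B)\mapsto AB$ with unit $I$ (systems may be reordered by deterministic swaps), and, for each pair $A,B$, a collection of tests $\{E_x\}_{x\in X}$ ($X$ a finite outcome set) made of events $E_x$ from $A$ to $B$; every event belongs to some test. Tests can be composed sequentially ($\circ$) and in parallel ($\boxtimes$), with identity events and the law $(\mathcal A\boxtimes\mathcal B)\circ(\mathcal C\boxtimes\mathcal D)=(\mathcal A\circ\mathcal C)\boxtimes(\mathcal B\circ\mathcal D)$ (a strict symmetric monoidal structure). Events from $I$ to $I$ are probabilities in $[0,1]$, composed by multiplication, and every test from $I$ to $I$ is a probability distribution. For a test $\{E_x\}_{x\in X}$ and $Y\subseteq X$ the coarse-graining $\sum_{y\in Y}E_y$ is an event (merging outcomes of a test gives a test), and both compositions distribute over sums. Events giving the same probabilities in all contexts are identified. States $\rho\in\mathsf{St}(A)$ are (classes of) events from $I$ to $A$; effects $a\in\mathsf{Eff}(A)$ are (classes of) events from $A$ to $I$; $(a|\rho)\in[0,1]$ is the resulting probability. Effects separate states and states separate effects, so $\mathsf{St}(A)$ is a subset of the real vector space $\mathsf{St}_{\mathbb R}(A)=\mathrm{span}_{\mathbb R}\,\mathsf{St}(A)$ and effects are linear functionals on it; sums of events are vector sums. $D_A=\dim\mathsf{St}_{\mathbb R}(A)$ is assumed finite for all $A$. The null state $\varepsilon=0$ always belongs to $\mathsf{St}(A)$. An event is deterministic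 if it forms a test with a single outcome (so the full coarse-graining of a test is deterministic); compositions of deterministic events are deterministic; a state is deterministic iff every deterministic effect takes value $1$ on it. Every system has at least one preparation test (input $I$) and one observation test (output $I$). $\mathsf{St}(A)$ need not be convex. A state may be written $|\rho)_A$; the parallel composition $|\rho)_A\boxtimes|\sigma)_B\in\mathsf{St}(AB)$ is written $|\rho)_A|\sigma)_B$. **Extremal and pure states; simplicial theory.** $\mathsf{ExtSt}(A)$ is the set of extreme points (extremal states) of the convex hull $\mathrm{Conv}(\mathsf{St}(A))$; it includes the null state $0$. Pure states are the deterministic extremal states. An OPT is simplicial if for every system $A$ the elements of $\mathsf{ExtSt}(A)$ are the vertices of a $D_A$-simplex, i.e. there are exactly $D_A+1$ of them, they are affinely independent, and their convex hull is $\mathrm{Conv}(\mathsf{St}(A))$. Thus $A$ has exactly $D_A$ non-null extremal states, written $|i)_A$ with $i\in\{1,\dots,D_A\}$. **$n$-local discriminability.** For every $m\ge n$ and every $m$-partite system $S_1\cdots S_m$, the effects obtained as conic combinations of parallel compositions $a_1\boxtimes\cdots\boxtimes a_l$, where each $a_j$ is an effect of a subsystem consisting of $k_j\le n$ of the $S_i$ (the subsystems forming a partition of $\{S_1,\dots,S_m\}$), separate the states of $S_1\cdots S_m$. **Scope.** It is not claimed that every choice of the coefficients $p^{ij}_k$ leads to a consistent theory.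
   Formalization: n-local discriminability is required to separate all vectors of the real span of the states (equivalently mixtures), not only the possibly non-convex set of states; otherwise the claim fails, e.g. for a theory whose pure states are partial matchings of points. *)

(* Defs.v *)
From mathcomp Require Import all_boot all_order all_algebra.
From mathcomp Require Import boolp classical_sets functions reals.

Set Implicit Arguments.
Unset Strict Implicit.
Unset Printing Implicit Defensive.

Import GRing.Theory.
Local Open Scope ring_scope.

Section OPT.
Variable R : realType.

(* The strict symmetric monoidal category of events is presented with a single
   type [ev] of events carrying a source and a target, so that strict
   associativity and unit laws are plain equalities.  [seqc g f] is "g after f"
   and is only constrained when [tgt f = src g]; [coarse E Y] is the
   coarse-graining of the events [E x], [x] in [Y], and is only constrained when
   [E] is a test; [prob] is only constrained on events from [unit_sys] to
   itself. *)
Record opt_core : Type := OptCore {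
  sys : Type;
  unit_sys : sys;
  comp_sys : sys -> sys -> sys;
  comp_sysA : forall A B C,
    comp_sys A (comp_sys B C) = comp_sys (comp_sys A B) C;
  comp_sys1s : forall A, comp_sys unit_sys A = A;
  comp_syss1 : forall A, comp_sys A unit_sys = A;

  ev : Type;
  src : ev -> sys;
  tgt : ev -> sys;
  hom (A B : sys) (f : ev) : Prop := src f = A /\ tgt f = B;

  idm : sys -> ev;
  seqc : ev -> ev -> ev;
  parc : ev -> ev -> ev;
  swap : sys -> sys -> ev;

  idm_hom : forall A, hom A A (idm A);
  seqc_hom : forall A B C f g, hom A B f -> hom B C g -> hom A C (seqc g f);
  parc_hom : forall A B C D f g, hom A B f -> hom C D g ->
    hom (comp_sys A C) (comp_sys B D) (parc f g);
  swap_hom : forall A B, hom (comp_sys A B) (comp_sys B A) (swap A B);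

  seqcA : forall A B C D f g h, hom A B f -> hom B C g -> hom C D h ->
    seqc h (seqc g f) = seqc (seqc h g) f;
  seqc1e : forall A B f, hom A B f -> seqc (idm B) f = f;
  seqce1 : forall A B f, hom A B f -> seqc f (idm A) = f;
  parcA : forall f g h, parc f (parc g h) = parc (parc f g) h;
  parc1e : forall f, parc (idm unit_sys) f = f;
  parce1 : forall f, parc f (idm unit_sys) = f;
  parc_idm : forall A B, parc (idm A) (idm B) = idm (comp_sys A B);
  interchange : forall A B C A' B' C' f g f' g',
    hom A B f -> hom B C g -> hom A' B' f' -> hom B' C' g' ->
    seqc (parc g g') (parc f f') = parc (seqc g f) (seqc g' f');
  swapK : forall A B, seqc (swap B A) (swap A B) = idm (comp_sys A B);
  swap_nat : forall A B C D f g, hom A C f -> hom B D g ->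
    seqc (swap C D) (parc f g) = seqc (parc g f) (swap A B);
  swap_hexagon : forall A B C, swap A (comp_sys B C) =
    seqc (parc (idm B) (swap A C)) (parc (swap A B) (idm C));

  test : sys -> sys -> forall X : finType, (X -> ev) -> Prop;
  det (A B : sys) (f : ev) : Prop := @test A B unit (fun=> f);
  test_hom : forall A B (X : finType) (E : X -> ev),
    test A B E -> forall x, hom A B (E x);
  ev_test : forall A B f, hom A B f ->
    exists (X : finType) (E : X -> ev), test A B E /\ exists x, E x = f;
  test_seqc : forall A B C (X Z : finType) (E : X -> ev) (F : Z -> ev),
    test A B E -> test B C F ->
    test A C (fun p : X * Z => seqc (F p.2) (E p.1));
  test_parc : forall A B C D (X Z : finType) (E : X -> ev) (F : Z -> ev),
    test A B E -> test C D F ->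
    test (comp_sys A C) (comp_sys B D)
         (fun p : X * Z => parc (E p.1) (F p.2));
  det_idm : forall A, det A A (idm A);
  det_swap : forall A B, det (comp_sys A B) (comp_sys B A) (swap A B);
  preparation : forall A, exists (X : finType) (E : X -> ev),
    test unit_sys A E;
  observation : forall A, exists (X : finType) (E : X -> ev),
    test A unit_sys E;

  (* Taking [Y] empty yields the null event, in particular the null state. *)
  coarse : forall X : finType, (X -> ev) -> {set X} -> ev;
  coarse_hom : forall A B (X : finType) (E : X -> ev) (Y : {set X}),
    test A B E -> hom A B (coarse E Y);
  coarse1 : forall A B (X : finType) (E : X -> ev) (x : X),
    test A B E -> coarse E [set x] = E x;
  test_merge : forall A B (X Z : finType) (E : X -> ev) (f : X -> Z),
    test A B E -> (forall z, exists x, f x = z) ->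
    test A B (fun z => coarse E [set x | f x == z]);
  coarse_seqc : forall A B C (X Z : finType) (E : X -> ev) (F : Z -> ev)
      (Y : {set X}) (W : {set Z}),
    test A B E -> test B C F ->
    seqc (coarse F W) (coarse E Y) =
    coarse (fun p : X * Z => seqc (F p.2) (E p.1)) (finset.setX Y W);
  coarse_parc : forall A B C D (X Z : finType) (E : X -> ev) (F : Z -> ev)
      (Y : {set X}) (W : {set Z}),
    test A B E -> test C D F ->
    parc (coarse E Y) (coarse F W) =
    coarse (fun p : X * Z => parc (E p.1) (F p.2)) (finset.setX Y W);

  prob : ev -> R;
  prob_itv : forall p, hom unit_sys unit_sys p -> 0 <= prob p <= 1;
  prob_seqc : forall p q, hom unit_sys unit_sys p -> hom unit_sys unit_sys q ->
    prob (seqc p q) = prob p * prob q;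
  prob_parc : forall p q, hom unit_sys unit_sys p -> hom unit_sys unit_sys q ->
    prob (parc p q) = prob p * prob q;
  prob_coarse : forall (X : finType) (E : X -> ev) (Y : {set X}),
    test unit_sys unit_sys E -> prob (coarse E Y) = \sum_(x in Y) prob (E x);
  prob_test : forall (X : finType) (E : X -> ev),
    test unit_sys unit_sys E -> \sum_x prob (E x) = 1;

  (* With [A] (resp. [B]) the unit system this says in particular that effects
     separate states (resp. states separate effects). *)
  ev_ext : forall A B f g, hom A B f -> hom A B g ->
    (forall C rho a,
       hom unit_sys (comp_sys A C) rho -> hom (comp_sys B C) unit_sys a ->
       prob (seqc a (seqc (parc f (idm C)) rho)) =
       prob (seqc a (seqc (parc g (idm C)) rho))) ->
    f = g;

  det_stateP : forall A rho, hom unit_sys A rho ->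
    (det unit_sys A rho <->
     forall e, det A unit_sys e -> prob (seqc e rho) = 1)
}.

End OPT.

Local Open Scope classical_set_scope.

Section Convex.
Variables (R : realType) (V : lmodType R).

Definition lin_span (S : set V) : set V :=
  [set x | exists (n : nat) (c : 'I_n -> R) (v : 'I_n -> V),
     (forall i, S (v i)) /\ x = \sum_i c i *: v i].

Definition lin_indep (n : nat) (v : 'I_n -> V) : Prop :=
  forall c : 'I_n -> R, \sum_i c i *: v i = 0 -> forall i, c i = 0.

Definition has_dim (U : set V) (d : nat) : Prop :=
  exists v : 'I_d -> V, lin_indep v /\ lin_span (range v) = U.

Definition affine_indep (n : nat) (v : 'I_n -> V) : Prop :=
  forall c : 'I_n -> R,
    \sum_i c i = 0 -> \sum_i c i *: v i = 0 -> forall i, c i = 0.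

Definition conv_hull (S : set V) : set V :=
  [set x | exists (n : nat) (c : 'I_n -> R) (v : 'I_n -> V),
     [/\ forall i, 0 <= c i, \sum_i c i = 1, forall i, S (v i)
       & x = \sum_i c i *: v i]].

Definition extreme_points (C : set V) : set V :=
  [set x | C x /\ forall (y z : V) (t : R), C y -> C z -> 0 < t < 1 ->
     x = t *: y + (1 - t) *: z -> y = x /\ z = x].

End Convex.

Section States.
Variables (R : realType) (T : opt_core R).

Definition St (A : sys T) : set (ev T) := hom (unit_sys T) A.
Definition Eff (A : sys T) : set (ev T) := hom A (unit_sys T).

(* The ambient real vector space of a system: functions on its effects.  A state
   is identified with the function a |-> (a|rho) (injectively, since effects
   separate states); an effect [a] then acts on a vector [v] as the linear
   functional [v a]. *)
Definition vect (A : sys T) := Eff A -> R^o.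
Definition svec (A : sys T) (rho : ev T) : vect A :=
  fun a => prob (seqc (val a) rho).
Arguments svec : clear implicits.

Definition StR (A : sys T) : set (vect A) := lin_span (svec A @` St A).
Arguments StR : clear implicits.
Definition ConvSt (A : sys T) : set (vect A) := conv_hull (svec A @` St A).
Arguments ConvSt : clear implicits.
Definition ExtSt (A : sys T) : set (vect A) := extreme_points (ConvSt A).
Arguments ExtSt : clear implicits.

Definition pure (A : sys T) : set (ev T) :=
  [set rho | [/\ St A rho, ExtSt A (svec A rho) & det (unit_sys T) A rho]].

End States.
Arguments svec {R T} A rho.
Arguments StR {R T} A.
Arguments ConvSt {R T} A.
Arguments ExtSt {R T} A.

Record opt (R : realType) : Type := Opt {
  opt_base :> opt_core R;
  dimSt : sys opt_base -> nat;
  dimStP : forall A, has_dim (StR A) (dimSt A)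
}.

Section Properties.
Variables (R : realType) (T : opt R).

Definition simplicial : Prop :=
  forall A : sys T, exists v : 'I_(dimSt A).+1 -> vect A,
    [/\ affine_indep v, range v = ExtSt A
      & conv_hull (range v) = ConvSt A].

Definition composite (s : seq (sys T)) : sys T :=
  \big[@comp_sys R T/unit_sys T]_(A <- s) A.

(* [reorder s t r]: [r] is the deterministic event from [composite s] to
   [composite t] permuting the factors of [s] into [t].  A permutation is
   decomposed by bringing the first factor of the target to the front with one
   swap and then permuting the remaining factors. *)
Inductive reorder : seq (sys T) -> seq (sys T) -> ev T -> Prop :=
| reorder_nil : reorder [::] [::] (idm (unit_sys T))
| reorder_cons A s1 s2 t r : reorder (s1 ++ s2) t r ->
    reorder (s1 ++ A :: s2) (A :: t)
      (seqc (parc (idm A) r)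
            (parc (swap (composite s1) A) (idm (composite s2)))).

(* Parallel compositions of effects a_1, ..., a_l of the blocks g_1, ..., g_l of
   a partition of the factors of [s] into blocks of at most [n] factors. *)
Definition block_product (n : nat) (s : seq (sys T)) : set (ev T) :=
  [set a | exists (l : nat) (g : 'I_l -> seq (sys T)) (e : 'I_l -> ev T)
      (r : ev T),
    [/\ forall j, (0 < size (g j) <= n)%N,
        forall j, Eff (composite (g j)) (e j),
        reorder s (flatten [seq g j | j <- enum 'I_l]) r
      & a = seqc (\big[@parc R T/idm (unit_sys T)]_(j < l) e j) r]].

Definition nlocal_effect (n : nat) (s : seq (sys T)) :
    set (Eff (composite s)) :=
  [set a | exists (N : nat) (c : 'I_N -> R) (q : 'I_N -> Eff (composite s)),
    [/\ forall i, 0 <= c i, forall i, block_product n s (val (q i))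
      & forall v : vect (composite s), StR _ v -> v a = \sum_i c i * v (q i)]].

(* Separation is required on the real span of the states, on which effects are
   linear functionals (equivalently, on statistical mixtures of states): the set
   of states itself need not be convex. *)
Definition nlocal_discriminability (n : nat) : Prop :=
  forall s : seq (sys T), (n <= size s)%N ->
  forall v w : vect (composite s), StR _ v -> StR _ w ->
    (forall a, nlocal_effect n a -> v a = w a) -> v = w.

(* [a] enumerates the non-null extremal states |1), ..., |D_A) of [A]. *)
Definition ext_enum (A : sys T) (a : 'I_(dimSt A) -> ev T) : Prop :=
  (forall i, St A (a i)) /\
  set_bij [set: 'I_(dimSt A)] (ExtSt A `\ 0) (fun i => svec A (a i)).

Section Composite.
Variables (A B : sys T).
Variables (a : 'I_(dimSt A) -> ev T) (b : 'I_(dimSt B) -> ev T).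

(* [lab i j k] is |(ij)_k), [p i j k] is p^{ij}_k. *)
Record labeling (I : 'I_(dimSt A) -> 'I_(dimSt B) -> finType)
    (lab : forall i j, I i j -> ev T) (p : forall i j, I i j -> R) : Prop := {
  labeling_bij :
    set_bij [set: {ij : 'I_(dimSt A) * 'I_(dimSt B) & I ij.1 ij.2}]
            (pure (comp_sys A B))
            (fun t => lab (tag t).1 (tag t).2 (tagged t));
  labeling_gt0 : forall i j k, 0 < p i j k;
  labeling_sum1 : forall i j, \sum_k p i j k = 1;
  labeling_decomp : forall i j,
    svec (comp_sys A B) (parc (a i) (b j)) =
    \sum_k p i j k *: (svec (comp_sys A B) (lab i j k) : vect _)
}.

End Composite.
End Properties.

(* Main.v *)
Require Import Defs.
From mathcomp Require Import all_boot all_order all_algebra.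
From mathcomp Require Import boolp classical_sets functions reals.
From mathcomp Require Import zify lra.
Local Open Scope classical_set_scope.
Local Open Scope ring_scope.

(* A non-null extremal state is deterministic: completing it, by the test it
   belongs to, to a deterministic state cannot leave the simplex.  So every
   deterministic state is a convex combination of pure states, and events map
   supports into supports.  Discarding B (or A) sends |i)|j) to the extremal
   state |i) (or |j)); hence distinct products |i)|j) have disjoint supports.

   That these supports exhaust the pure states of AB follows from a comparison
   of growth rates.  If a pure state kappa occurred in no |i)|j), its support
   would be disjoint from that of every product state.  Place N copies of kappa
   along each of the N! perfect matchings between the factors of A^N and B^N.
   For two different matchings, some pair A_i B_j is linked in only one of them,
   and its marginal is kappa in one case and a product state in the other; so
   the supports are pairwise disjoint and D(A^N B^N) >= N!.  On the other hand,
   cut a word w in A and B into n + 1 composite systems.  Effects that factorize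
   over blocks of at most n of them also factorize over a bipartition, whence
   D(w) <= sum D(w1) D(w2) over a number of splittings that depends only on n.
   By induction D(w) <= K^|w|, which contradicts D(A^N B^N) >= N!. *)

Set Implicit Arguments.
Unset Strict Implicit.
Unset Printing Implicit Defensive.

Import Order.TTheory GRing.Theory Num.Theory.
Import Defs.

Local Notation "A \s B" := (comp_sys A B) (at level 40, left associativity).
Local Notation "f \p g" := (parc f g) (at level 40, left associativity).
Local Notation "g \c f" := (seqc g f) (at level 45, left associativity).

(** * Deterministic events *)

Section Events.
Variables (R : realType) (T : opt_core R).
Local Notation U := (unit_sys T).
Implicit Types (A B C D X Y Z : sys T) (f g rho : ev T).

Lemma hom_par_state A B rho sigma :
  hom U A rho -> hom U B sigma -> hom U (A \s B) (rho \p sigma).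
Proof. by move=> hr hs; rewrite -(comp_sys1s U); apply: parc_hom. Qed.

Lemma hom_par_eff A B f g :
  hom A U f -> hom B U g -> hom (A \s B) U (f \p g).
Proof. by move=> hr hs; rewrite -[X in hom _ X](comp_sys1s U); apply: parc_hom. Qed.

Lemma hom_par_effl A B C f g :
  hom A U f -> hom B C g -> hom (A \s B) C (f \p g).
Proof. by move=> hr hs; rewrite -[C](comp_sys1s C); apply: parc_hom. Qed.

Lemma hom_par_effr A B C f g :
  hom A C f -> hom B U g -> hom (A \s B) C (f \p g).
Proof. by move=> hr hs; rewrite -[C](comp_syss1 C); apply: parc_hom. Qed.

Lemma det_hom A B f : det A B f -> hom A B f.
Proof. by move=> /test_hom /(_ tt). Qed.

Lemma det_coarseT A B (X : finType) (E : X -> ev T) :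
  test A B E -> X -> det A B (coarse E [set: X]%SET).
Proof.
move=> tE x0.
have surj (z : unit) : exists x : X, (fun=> tt) x = z by exists x0; case: z.
have := test_merge tE surj; rewrite /det; congr test; apply/funext => z; congr coarse.
Qed.

Lemma det_seqc A B C f g : det A B f -> det B C g -> det A C (g \c f).
Proof.
move=> df dg; have tE := test_seqc df dg.
have := det_coarseT tE (tt, tt); congr det.
rewrite (_ : finset.setTfor _ = [set (tt, tt)]%SET) ?(coarse1 _ tE) //.
by apply/setP => -[[] []]; rewrite !inE.
Qed.

Lemma det_parc A B C D f g : det A B f -> det C D g ->
  det (A \s C) (B \s D) (f \p g).
Proof.
move=> df dg; have tE := test_parc df dg.
have := det_coarseT tE (tt, tt); congr det.
rewrite (_ : finset.setTfor _ = [set (tt, tt)]%SET) ?(coarse1 _ tE) //.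
by apply/setP => -[[] []]; rewrite !inE.
Qed.

Lemma det_par_state A B rho sigma :
  det U A rho -> det U B sigma -> det U (A \s B) (rho \p sigma).
Proof. by move=> hr hs; rewrite -(comp_sys1s U); apply: det_parc. Qed.

Lemma det_par_eff A B f g :
  det A U f -> det B U g -> det (A \s B) U (f \p g).
Proof. by move=> hr hs; rewrite -[X in det _ X](comp_sys1s U); apply: det_parc. Qed.

(** A preparation followed by an observation has probabilities summing to 1, so the observation test
    has an outcome and can be fully coarse-grained. *)
Lemma det_eff_exists A : exists e, det A U e.
Proof.
have [X [E tE]] := observation A; have [Z [F tF]] := preparation A.
have /prob_test := test_seqc tF tE.
have [x _|X0] := pickP (fun _ : X => true).
  by move=> _; exists (coarse E [set: X]%SET); apply: det_coarseT.
move=> /eqP; rewrite big_pred0 ?(eq_sym 0) ?oner_eq0 // => -[z x].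
by have := X0 x.
Qed.

Lemma prob_det p : det U U p -> prob p = 1.
Proof.
move=> dp; have := prob_test dp.
by rewrite (bigD1 tt) //= big_pred0 ?addr0 // => -[].
Qed.

(** The hexagon with two trivial factors makes [swap A U] idempotent, and [swapK] gives it a left
    inverse. *)
Lemma swap1 A : swap A U = idm A.
Proof.
have h1 : hom A A (swap A U).
  by have := swap_hom A U; rewrite comp_sys1s comp_syss1.
have h2 : hom A A (swap U A).
  by have := swap_hom U A; rewrite comp_sys1s comp_syss1.
have K : swap U A \c swap A U = idm A by rewrite swapK comp_syss1.
have H : swap A U \c swap A U = swap A U.
  by have := swap_hexagon A U U; rewrite comp_sys1s parc1e parce1.
by have := seqcA h1 h1 h2; rewrite H K (seqc1e h1).
Qed.
End Events.

(** * State vectors *)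

Section Convexity.
Variables (R : realType) (V : lmodType R).

Lemma sum_reindex (I J : finType) (s : I -> J) (c : I -> R) (v : J -> V) :
  \sum_i c i *: v (s i) = \sum_j (\sum_(i | s i == j) c i) *: v j.
Proof.
under [RHS]eq_bigr do rewrite scaler_suml.
rewrite (exchange_big_dep xpredT) //=; apply: eq_bigr => i _.
by rewrite (big_pred1 (s i)) // => j; rewrite eq_sym.
Qed.

Lemma lin_indep_inj n (v : 'I_n -> V) (c d : 'I_n -> R) : lin_indep v ->
  \sum_i c i *: v i = \sum_i d i *: v i -> c =1 d.
Proof.
move=> fv e i; apply/eqP; rewrite -subr_eq0; apply/eqP.
apply: (fv (fun i => c i - d i)).
under eq_bigr do rewrite scalerBl.
by rewrite sumrB e subrr.
Qed.

Lemma affine_indep_inj n (v : 'I_n -> V) : affine_indep v -> injective v.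
Proof.
move=> av i j e; apply/eqP/negP => /negP ne.
pose c k : R := (k == i)%:R - (k == j)%:R.
have E (W : lmodType R) (w : 'I_n -> W) : \sum_k c k *: w k = w i - w j.
  under eq_bigr do rewrite scalerBl.
  have D l : \sum_k (k == l)%:R *: w k = w l.
    rewrite (bigD1 l) //= eqxx scale1r big1 ?addr0 // => k /negbTE ->.
    by rewrite scale0r.
  by rewrite sumrB !D.
have c0 : \sum_k c k = 0.
  have := E R^o (fun=> 1); rewrite subrr => {2}<-.
  by apply: eq_bigr => k _; rewrite /GRing.scale /= mulr1.
have := av c c0; rewrite E e subrr => /(_ erefl i).
by rewrite /c eqxx (negbTE ne) subr0 => /eqP; rewrite oner_eq0.
Qed.

Lemma conv_hullS (S : set V) : S `<=` conv_hull S.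
Proof.
move=> x Sx; exists 1%N, (fun=> 1), (fun=> x); split=> //.
- by rewrite big_ord1.
- by rewrite big_ord1 scale1r.
Qed.

(** Split off one point of positive weight from a convex combination; the rest, renormalized, stays
    in the hull, so extremality forces the split-off point to be [x]. *)
Lemma extreme_conv_hull (S : set V) x : extreme_points (conv_hull S) x -> S x.
Proof.
move=> [[n [c [v [c0 c1 Sv xE]]]] ext].
have [i ci0] : exists i, 0 < c i.
  apply/existsP; apply: contraTT (ltr01 : 0 < 1 :> R) => /existsPn c_le0.
  by rewrite -c1 -leNgt sumr_le0 // => i _; rewrite leNgt c_le0.
have sumE : c i + \sum_(j | j != i) c j = 1 by rewrite -c1 [RHS](bigD1 i).
have [ci1|ci1] := eqVneq (c i) 1.
  have /psumr_eq0P z : \sum_(j | j != i) c j = 0 by lra.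
  rewrite xE (bigD1 i) //= ci1 scale1r big1 ?addr0 // => j ji.
  by rewrite z // scale0r.
have ci_lt1 : c i < 1.
  by rewrite lt_neqAle ci1 -sumE lerDl sumr_ge0.
have d0 : 1 - c i != 0 by rewrite subr_eq0 eq_sym.
pose z := \sum_(j | j != i) (c j / (1 - c i)) *: v j.
have Cz : conv_hull S z.
  exists n, (fun j => if j == i then 0 else c j / (1 - c i)), v; split=> //.
  - by move=> j; case: ifP => // _; rewrite divr_ge0 // subr_ge0 ltW.
  - rewrite (bigD1 i) //= eqxx add0r.
    under eq_bigr => j /negbTE -> do [].
    by rewrite -mulr_suml (_ : \sum_(j | _) _ = 1 - c i) ?divff //; lra.
  - rewrite [RHS](bigD1 i) //= eqxx scale0r add0r.
    by apply: eq_bigr => j /negbTE ->.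
have [] // := ext (v i) z (c i) (conv_hullS (Sv i)) Cz.
- by rewrite ci0.
- rewrite xE (bigD1 i) //=; congr (_ + _); rewrite scaler_sumr.
  by apply: eq_bigr => j _; rewrite scalerA mulrCA divff // mulr1.
by move=> <-.
Qed.

End Convexity.

Section StateVectors.
Variables (R : realType) (T : opt_core R).
Local Notation U := (unit_sys T).
Implicit Types (A B C X Y : sys T) (f g rho : ev T).

Definition mkeff X f (h : hom X U f) : Eff X := exist _ f (mem_set h).

Lemma eff_hom X (x : Eff X) : hom X U (val x).
Proof. exact: set_mem (valP x). Qed.

Lemma vect_sumE X n (c : 'I_n -> R) (v : 'I_n -> vect X) (x : Eff X) :
  (\sum_i c i *: v i) x = \sum_i c i * v i x.
Proof. by rewrite fct_sumE. Qed.

Lemma svec_ge0 X rho x : St X rho -> 0 <= svec X rho x.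
Proof.
by move=> hr; have /andP[] := prob_itv (seqc_hom hr (eff_hom x)).
Qed.

(** Complete the effect to a test: in the composite test the coarse-graining runs over [W] times a
    single outcome. *)
Lemma svec_coarse X (Z : finType) (E : Z -> ev T) (W : {set Z}) : test U X E ->
  svec X (coarse E W) = \sum_(z in W) (svec X (E z) : vect X).
Proof.
move=> tE; apply/funext => x; rewrite fct_sumE /svec.
have [Q [F [tF [q <-]]]] := ev_test (eff_hom x).
rewrite -(coarse1 q tF) (coarse_seqc _ _ tE tF) prob_coarse; last exact: (test_seqc tE tF).
rewrite (coarse1 q tF) (eq_bigl (fun p => (p.1 \in W) && (p.2 == q))).
  rewrite -(pair_big_dep _ (fun _ q' => q' == q)
              (fun z q' => prob (F q' \c E z))) /=.
  by apply: eq_bigr => z _; rewrite big_pred1_eq.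
by move=> [z q'] /=; rewrite !inE.
Qed.

(** For states the context of [ev_ext] collapses: its input is a state [t] of the ancilla alone, and
    [t] together with the final effect forms a single effect on [X]. *)
Lemma svec_inj X rho sigma : St X rho -> St X sigma ->
  svec X rho = svec X sigma -> rho = sigma.
Proof.
move=> hr hs e; apply: (ev_ext hr hs) => C t a ht ha.
have {}ht : hom U C t by rewrite -(comp_sys1s C).
suff E f : hom U X f -> hom X U (a \c (idm X \p t)) /\
    a \c (f \p idm C \c t) = a \c (idm X \p t) \c f.
  have [h _] := E _ hr.
  rewrite (E _ hr).2 (E _ hs).2.
  exact: (congr1 (fun w => w (mkeff h)) e).
move=> hf.
have h1 : hom X (X \s C) (idm X \p t).
  by have := parc_hom (idm_hom X) ht; rewrite comp_syss1.
split; first exact: seqc_hom h1 ha.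
rewrite -(seqcA hf h1 ha); congr (_ \c _).
rewrite -{1}(parc1e t) -{2}(parce1 f).
rewrite (interchange (idm_hom U) hf ht (idm_hom C)).
rewrite (interchange hf (idm_hom X) (idm_hom U) ht).
by rewrite (seqce1 hf) (seqc1e hf) (seqce1 ht) (seqc1e ht).
Qed.

Lemma prob_one p : hom U U p -> prob p = 1 -> p = idm U.
Proof.
move=> hp p1; have hU := idm_hom U.
apply: (svec_inj (X := U)) => //.
apply/funext => x; have hx := eff_hom x.
by rewrite /svec !prob_seqc // p1 (prob_det (det_idm U)).
Qed.

Lemma det_scalar p : det U U p -> p = idm U.
Proof. by move=> dp; apply: prob_one; [apply: det_hom | apply: prob_det]. Qed.

Lemma svec_seqc X Y f rho (x : Eff Y) (hf : hom X Y f) : St X rho ->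
  svec Y (f \c rho) x = svec X rho (mkeff (seqc_hom hf (eff_hom x))).
Proof. by move=> hr; rewrite /svec (seqcA hr hf (eff_hom x)). Qed.

Lemma svec_seqc_sum X Y f rho n (c : 'I_n -> R) (t : 'I_n -> ev T) :
  hom X Y f -> St X rho -> (forall i, St X (t i)) ->
  svec X rho = \sum_i c i *: (svec X (t i) : vect X) ->
  svec Y (f \c rho) = \sum_i c i *: (svec Y (f \c t i) : vect Y).
Proof.
move=> hf hr ht e; apply/funext => x; rewrite (svec_seqc x hf hr) e !vect_sumE.
by apply: eq_bigr => i _; rewrite (svec_seqc x hf (ht i)).
Qed.

Lemma null_state X : exists2 rho, St X rho & svec X rho = 0.
Proof.
have [Z [E tE]] := preparation X; exists (coarse E finset.set0).
  exact: coarse_hom.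
by rewrite (svec_coarse _ tE) big_set0.
Qed.

Lemma ConvSt_ge0 X v x : ConvSt X v -> 0 <= v x.
Proof.
move=> [n [c [w [c0 _ Sw ->]]]]; rewrite vect_sumE sumr_ge0 // => i _.
by apply: mulr_ge0 => //; have [rho hr <-] := Sw i; apply: svec_ge0.
Qed.

(** Vectors of the hull are nonnegative on effects, so a mixture with positive weights vanishes only
    if both members do. *)
Lemma null_ext X : ExtSt X 0.
Proof.
split.
  by have [rho hr <-] := null_state X; apply: conv_hullS; exists rho.
move=> y z t Cy Cz /andP[t0 t1] e.
have K x : y x = 0 /\ z x = 0.
  have := congr1 (fun w => w x) e; rewrite /= => {}e.
  have y0 := ConvSt_ge0 x Cy; have z0 := ConvSt_ge0 x Cz.
  have {}e : 0 = t * y x + (1 - t) * z x := e.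
  have ty : 0 <= t * y x by rewrite mulr_ge0 // ltW.
  have tz : 0 <= (1 - t) * z x by rewrite mulr_ge0 // subr_ge0 ltW.
  split; apply/eqP.
    have /eqP : t * y x = 0 by lra.
    by rewrite mulf_eq0 gt_eqF.
  have /eqP : (1 - t) * z x = 0 by lra.
  by rewrite mulf_eq0 subr_eq0 (gt_eqF t1).
by split; apply/funext => x; have [] := K x.
Qed.

End StateVectors.

(** * Supports in a simplicial theory *)

Section Simplicial.
Variables (R : realType) (T : opt R).
Hypothesis T_simplicial : simplicial T.
Local Notation U := (unit_sys T).
Implicit Types (A B C X Y : sys T) (f g rho tau sigma : ev T).

Lemma ext_enum_exists X : exists u : 'I_(dimSt X) -> ev T, ext_enum u.
Proof.
have [v [av rv _]] := T_simplicial X; have vI := affine_indep_inj av.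
have [i0 _ vi0] : range v 0 by rewrite rv; apply: null_ext.
(* [i0] is the index of the null vertex and [lift i0] enumerates the others, each of which comes
   from an actual state. *)
have /choice [u hu] j : exists t, St X t /\ svec X t = v (lift i0 j).
  have : ExtSt X (v (lift i0 j)) by rewrite -rv; exists (lift i0 j).
  by move=> /extreme_conv_hull [t ht e]; exists t.
exists u; split=> [i|]; first by have [] := hu i.
split.
- move=> i _ /=; have [_ ->] := hu i; split.
    by rewrite -rv; exists (lift i0 i).
  by rewrite -vi0 => /vI /eqP; apply/negP; rewrite eq_sym neq_lift.
- move=> i j _ _ /=; have [_ ->] := hu i; have [_ ->] := hu j.
  by move=> /vI /lift_inj.
- move=> w [Ew w0]; have [i _ iw] : range v w by rewrite rv.
  have [j ij|ii0] := unliftP i0 i; last by case: w0; rewrite -iw ii0 vi0.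
  by exists j => //; have [_ ->] := hu j; rewrite -ij.
Qed.

Lemma ext_enum_inj X (u : 'I_(dimSt X) -> ev T) : ext_enum u -> injective u.
Proof. by move=> [_ [_ uI _]] k l e; apply: uI; rewrite ?inE //= e. Qed.

Lemma ext_enum_free X (u : 'I_(dimSt X) -> ev T) :
  ext_enum u -> lin_indep (fun i => svec X (u i) : vect X).
Proof.
move=> [_ [u1 uI _]]; have [v [av rv _]] := T_simplicial X.
have [i0 _ vi0] : range v 0 by rewrite rv; apply: null_ext.
have /choice [s hs] j : exists i, v i = svec X (u j).
  have [Eu _] := u1 j I; have : range v (svec X (u j)) by rewrite rv.
  by move=> [i _ <-]; exists i.
have sI : injective s.
  by move=> i j e; apply: uI; rewrite ?inE //= -!hs e.
have si0 j : s j != i0.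
  apply/eqP => e; have [_] := u1 j I; apply.
  by rewrite /= -hs e.
move=> c e i.
pose d k : R := \sum_(j | s j == k) c j.
have e' : \sum_k d k *: v k = 0.
  by rewrite /d -sum_reindex -[RHS]e; apply: eq_bigr => j _; rewrite hs.
(* The null vertex absorbs the total weight: subtracting [S] at [i0] keeps the vector sum and makes
   the coefficients sum to 0, as affine independence requires. *)
pose S := \sum_k d k; pose d' k : R := d k - (k == i0)%:R * S.
have d'0 k : d' k = 0.
  apply: (av d').
    rewrite /d' sumrB -/S -mulr_suml (bigD1 i0) //= eqxx big1 ?addr0 ?mul1r ?subrr //.
    by move=> j /negbTE ->.
  rewrite -[RHS]e'; apply: eq_bigr => j _; rewrite /d'.
  by have [->|_] := eqVneq j i0; rewrite ?vi0 ?scaler0 // mul0r subr0.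
have := d'0 (s i); rewrite /d' (negbTE (si0 i)) mul0r subr0 /d.
by rewrite (big_pred1 i) // => j; rewrite (inj_eq sI).
Qed.

(* The coefficients sum to at most 1 because the null state is the remaining
   vertex of the simplex. *)
Definition coords X (u : 'I_(dimSt X) -> ev T) (v : vect X) (c : 'I_(dimSt X) -> R) :=
  [/\ forall i, 0 <= c i, \sum_i c i <= 1
    & v = \sum_i c i *: (svec X (u i) : vect X)].

Lemma coords_delta X (u : 'I_(dimSt X) -> ev T) k :
  coords u (svec X (u k)) (fun i => (i == k)%:R).
Proof.
split=> [i||]; first exact: ler0n.
- by rewrite (bigD1 k) //= eqxx big1 ?addr0 // => i /negbTE ->.
- rewrite (bigD1 k) //= eqxx scale1r big1 ?addr0 // => i /negbTE ->.
  by rewrite scale0r.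
Qed.

Lemma coords_mix X (u : 'I_(dimSt X) -> ev T) n (c : 'I_n -> R)
    (w : 'I_n -> vect X) d :
  (forall i, 0 <= c i) -> \sum_i c i <= 1 -> (forall i, coords u (w i) (d i)) ->
  coords u (\sum_i c i *: w i) (fun j => \sum_i c i * d i j).
Proof.
move=> c0 c1 hd; split.
- by move=> j; rewrite sumr_ge0 // => i _; rewrite mulr_ge0 //; have [] := hd i.
- rewrite exchange_big /=; apply: le_trans c1; apply: ler_sum => i _.
  have [_ d1 _] := hd i.
  by rewrite -mulr_sumr ler_piMr.
- under [RHS]eq_bigr do rewrite scaler_suml.
  rewrite exchange_big /=; apply: eq_bigr => i _; have [_ _ {1}->] := hd i.
  by rewrite scaler_sumr; apply: eq_bigr => j _; rewrite scalerA.
Qed.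

Lemma coords_ConvSt X (u : 'I_(dimSt X) -> ev T) v :
  ext_enum u -> ConvSt X v -> exists c, coords u v c.
Proof.
move=> [_ [_ _ us]]; have [w [_ rw <-]] := T_simplicial X.
rewrite rw => -[n [c [x [c0 c1 Ex ->]]]].
have /choice [d hd] i : exists d, coords u (x i) d.
  have [x0|/eqP x0] := pselect (x i = 0).
    exists (fun=> 0); split=> //; first by rewrite big1 ?ler01.
    by rewrite big1 // => j _; rewrite scale0r.
  have [|k _ <-] := us (x i); first by split=> //; apply/eqP.
  by exists (fun i => (i == k)%:R); apply: coords_delta.
by exists (fun j => \sum_i c i * d i j); apply: coords_mix; rewrite ?c1.
Qed.

Lemma coords_exist X (u : 'I_(dimSt X) -> ev T) rho :
  ext_enum u -> St X rho -> exists c, coords u (svec X rho) c.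
Proof.
by move=> hu hr; apply: coords_ConvSt hu _; apply: conv_hullS; exists rho.
Qed.

Lemma ext_det X (u : 'I_(dimSt X) -> ev T) k : ext_enum u -> det U X (u k).
Proof.
move=> hu; have hk := hu.1 k.
have [Z [E [tE [z Ez]]]] := ev_test hk.
pose tau := coarse E [set~ z]%SET; pose delta := coarse E [set: Z]%SET.
have htau : St X tau by apply: coarse_hom.
have ddelta : det U X delta by apply: det_coarseT.
have e : svec X delta = (svec X (u k) : vect X) + svec X tau.
  rewrite !(svec_coarse _ tE) (bigD1 z) ?inE //= Ez; congr (_ + _).
  by apply: eq_bigl => x; rewrite !inE.
have [c hc] := coords_exist hu htau.
have [d hd] := coords_exist hu (det_hom ddelta).
have dE : d =1 (fun i => (i == k)%:R + c i).
  apply: (lin_indep_inj (ext_enum_free hu)); have [_ _ <-] := hd; rewrite e.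
  have [_ _ {1}->] := coords_delta u k; have [_ _ {1}->] := hc.
  by rewrite -big_split; apply: eq_bigr => i _; rewrite scalerDl.
have [_ d1 _] := hd; have [c0 _ ctau] := hc.
(* The total weight of [delta] is 1 plus that of [tau], and it cannot exceed 1; hence [tau] is null
   and [u k] equals [delta]. *)
have : \sum_i c i = 0.
  apply/eqP; rewrite eq_le sumr_ge0 // andbT.
  move: d1; rewrite (eq_bigr _ (fun i _ => dE i)) big_split /= (bigD1 k) //= eqxx.
  by rewrite big1 ?addr0 ?gerDl // => i /negbTE ->.
move=> /psumr_eq0P cz; suff -> : u k = delta by [].
apply: (svec_inj hk (det_hom ddelta)); rewrite e ctau big1 ?addr0 // => i _.
by rewrite cz ?scale0r.
Qed.

Lemma det_eff_coords X (u : 'I_(dimSt X) -> ev T) rho c e :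
  ext_enum u -> coords u (svec X rho) c -> det X U e ->
  prob (e \c rho) = \sum_i c i.
Proof.
move=> hu [_ _ hc] de.
have := congr1 (fun w => w (mkeff (det_hom de))) hc; rewrite vect_sumE /= => E.
rewrite [LHS]E; apply: eq_bigr => i _.
rewrite -[RHS]mulr1; congr (_ * _).
exact: (det_stateP (hu.1 i)).1 (ext_det i hu) e de.
Qed.

Lemma coords_det X (u : 'I_(dimSt X) -> ev T) rho c :
  ext_enum u -> coords u (svec X rho) c -> det U X rho -> \sum_i c i = 1.
Proof.
move=> hu hc dr; have [e de] := det_eff_exists X.
rewrite -(det_eff_coords hu hc de).
exact: (det_stateP (det_hom dr)).1 dr e de.
Qed.

(** The support of [rho] consists of the extremal states of positive weight; by [occursP] it does
    not depend on the enumeration. *)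
Definition occurs X rho tau := exists (u : 'I_(dimSt X) -> ev T) c k,
  [/\ ext_enum u, coords u (svec X rho) c, u k = tau & 0 < c k].

Lemma occursP X (u : 'I_(dimSt X) -> ev T) rho c tau :
  ext_enum u -> coords u (svec X rho) c ->
  occurs X rho tau <-> exists2 k, u k = tau & 0 < c k.
Proof.
move=> hu hc; split=> [|[k uk ck]]; last by exists u, c, k.
move=> [u' [c' [k' [hu' [c'0 _ e'] <- ck']]]].
have [hu1 [_ _ us]] := hu; have [hu'1 [u'1 u'2 _]] := hu'.
have /choice [s hs] i : exists j, svec X (u j) = svec X (u' i).
  by have [j _ <-] := us _ (u'1 i Logic.I); exists j.
exists (s k'); first exact: svec_inj (hs k').
have [_ _ e] := hc.
(* [s] matches the two enumerations; by linear independence, a weight for [u] is the sum of the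
   weights for [u'] over a fibre of [s]. *)
have -> : c (s k') = \sum_(i | s i == s k') c' i.
  apply: (lin_indep_inj (ext_enum_free hu) (d := fun j => \sum_(i | s i == j) c' i)).
  by rewrite -e e' -sum_reindex; apply: eq_bigr => i _; rewrite hs.
by apply: lt_le_trans ck' _; rewrite (bigD1 k') //= lerDl sumr_ge0.
Qed.

Lemma occurs_det X rho tau : occurs X rho tau -> det U X tau.
Proof. by move=> [u [c [k [hu _ <- _]]]]; apply: ext_det. Qed.

Lemma occurs_ext X (u : 'I_(dimSt X) -> ev T) k tau :
  ext_enum u -> occurs X (u k) tau -> tau = u k.
Proof.
move=> hu /(occursP _ hu (coords_delta u k)) [i <-].
by case: eqP => [->//|_]; rewrite ltxx.
Qed.

Lemma occurs_exists X rho : det U X rho -> exists tau, occurs X rho tau.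
Proof.
move=> dr; have [u hu] := ext_enum_exists X.
have [c hc] := coords_exist hu (det_hom dr).
have [k ck] : exists k, 0 < c k.
  apply/existsP; apply: contraTT (ltr01 : 0 < 1 :> R) => /existsPn c_le0.
  by rewrite -(coords_det hu hc dr) -leNgt sumr_le0 // => i _; rewrite leNgt c_le0.
by exists (u k), u, c, k.
Qed.

Lemma coords_seqc X Y f (u : 'I_(dimSt X) -> ev T) (w : 'I_(dimSt Y) -> ev T)
    rho c d : ext_enum u -> hom X Y f -> St X rho -> coords u (svec X rho) c ->
  (forall i, coords w (svec Y (f \c u i)) (d i)) ->
  coords w (svec Y (f \c rho)) (fun j => \sum_i c i * d i j).
Proof.
move=> hu hf hr [c0 c1 e] hd.
rewrite (svec_seqc_sum hf hr hu.1 e); exact: coords_mix.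
Qed.

(** Weights are nonnegative, so nothing cancels: the contribution of [tau] alone already gives
    [omega] a positive weight. *)
Lemma occurs_map X Y f rho tau omega : hom X Y f -> St X rho ->
  occurs X rho tau -> occurs Y (f \c tau) omega -> occurs Y (f \c rho) omega.
Proof.
move=> hf hr [u [c [k [hu hc <- ck]]]].
have [w hw] := ext_enum_exists Y.
have /choice [d hd] i : exists d, coords w (svec Y (f \c u i)) d.
  exact: coords_exist hw (seqc_hom (hu.1 i) hf).
move=> /(occursP _ hw (hd k)) [j <- dj].
apply/(occursP _ hw (coords_seqc hu hf hr hc hd)); exists j => //.
rewrite (bigD1 k) //=; apply: ltr_pwDl; first exact: mulr_gt0.
rewrite sumr_ge0 // => i _; rewrite mulr_ge0 //; first by have [] := hc.
by have [] := hd i.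
Qed.

Lemma occurs_seqc X Y f (u : 'I_(dimSt X) -> ev T) rho omega :
  ext_enum u -> hom X Y f -> St X rho -> occurs Y (f \c rho) omega ->
  exists i, occurs Y (f \c u i) omega.
Proof.
move=> hu hf hr; have [c hc] := coords_exist hu hr.
have [w hw] := ext_enum_exists Y.
have /choice [d hd] i : exists d, coords w (svec Y (f \c u i)) d.
  exact: coords_exist hw (seqc_hom (hu.1 i) hf).
move=> /(occursP _ hw (coords_seqc hu hf hr hc hd)) [j <- sgt].
have [i di] : exists i, 0 < d i j.
  apply/existsP; apply: contraTT sgt => /existsPn d_le0.
  rewrite -leNgt sumr_le0 // => i _; rewrite mulr_ge0_le0 //.
    by have [] := hc.
  by rewrite leNgt d_le0.
by exists i; apply/(occursP _ hw (hd i)); exists j.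
Qed.

Definition perp X rho sigma :=
  forall tau, occurs X rho tau -> occurs X sigma tau -> False.

(** A common vertex is deterministic, so its image is too and has a non-empty support, which lies in
    the supports of both images. *)
Lemma perp_seqc X Y f rho sigma : det X Y f -> St X rho -> St X sigma ->
  perp Y (f \c rho) (f \c sigma) -> perp X rho sigma.
Proof.
move=> df hr hs p tau rt st.
have [omega ho] := occurs_exists (det_seqc (occurs_det rt) df).
have hf := det_hom df.
by apply: (p omega); [apply: occurs_map rt ho | apply: occurs_map st ho].
Qed.

Lemma perpC X rho sigma : perp X rho sigma -> perp X sigma rho.
Proof. by move=> p tau h1 h2; apply: (p tau). Qed.

(** The supports are non-empty and disjoint, so choosing a vertex in each is injective. *)
Lemma perp_card X (J : finType) (t : J -> ev T) :
  (forall j, det U X (t j)) -> (forall i j, i != j -> perp X (t i) (t j)) ->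
  (#|J| <= dimSt X)%N.
Proof.
move=> dt pt; have [u hu] := ext_enum_exists X.
have /choice [k hk] j : exists k, occurs X (t j) (u k).
  have [c hc] := coords_exist hu (det_hom (dt j)).
  have [tau ht] := occurs_exists (dt j).
  by move/(occursP _ hu hc): (ht) => [k uk _]; exists k; rewrite uk.
rewrite -[X in (_ <= X)%N]card_ord; apply: (leq_card k) => i j e.
apply/eqP/negP => /negP /pt /(_ (u (k i)) (hk i)); apply.
by rewrite e.
Qed.

End Simplicial.

(** * Factorial lower bound on dimensions *)

Section Linking.
Variables (R : realType) (T : opt R).
Hypothesis T_simplicial : simplicial T.
Local Notation U := (unit_sys T).
Implicit Types (A B C X Y Z : sys T) (f g h rho tau sigma : ev T).

Lemma swap1s A : swap U A = idm A.
Proof.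
have := swapK A U; rewrite swap1 comp_syss1 => <-.
have h : hom A A (swap U A).
  by have := swap_hom U A; rewrite comp_sys1s comp_syss1.
by rewrite (seqce1 h).
Qed.

Definition shuffle A B Y Z : ev T := idm A \p swap B Y \p idm Z.

Lemma shuffle_hom A B Y Z :
  hom (A \s B \s (Y \s Z)) (A \s Y \s B \s Z) (shuffle A B Y Z).
Proof.
rewrite [A \s B \s _]comp_sysA -(comp_sysA A B Y) -(comp_sysA A Y B).
have hP := parc_hom (idm_hom A) (swap_hom B Y).
exact: parc_hom hP (idm_hom Z).
Qed.

Lemma shuffle_det A B Y Z :
  det (A \s B \s (Y \s Z)) (A \s Y \s B \s Z) (shuffle A B Y Z).
Proof.
rewrite [A \s B \s _]comp_sysA -(comp_sysA A B Y) -(comp_sysA A Y B).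
have hP := det_parc (det_idm A) (det_swap B Y).
exact: det_parc hP (det_idm Z).
Qed.

Lemma shuffle_nat A B Y Z A' B' Y' Z' f g y z :
  hom A A' f -> hom B B' g -> hom Y Y' y -> hom Z Z' z ->
  f \p y \p g \p z \c shuffle A B Y Z =
  shuffle A' B' Y' Z' \c (f \p g \p (y \p z)).
Proof.
move=> hf hg hy hz; rewrite /shuffle -(parcA f y g) [f \p g \p _]parcA -(parcA f g y).
have h1 := parc_hom (idm_hom A) (swap_hom B Y).
have h2 := parc_hom hf (parc_hom hy hg).
have h3 := parc_hom (idm_hom A') (swap_hom B' Y').
have h4 := parc_hom hf (parc_hom hg hy).
rewrite (interchange h1 h2 (idm_hom Z) hz).
rewrite (interchange (idm_hom A) hf (swap_hom B Y) (parc_hom hy hg)).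
rewrite (interchange h4 h3 hz (idm_hom Z')).
rewrite (interchange hf (idm_hom A') (parc_hom hg hy) (swap_hom B' Y')).
by rewrite (seqce1 hf) (seqc1e hf) (seqce1 hz) (seqc1e hz) (swap_nat hg hy).
Qed.

Lemma shuffle1l A Y Z : shuffle A U Y Z = idm (A \s (Y \s Z)).
Proof. by rewrite /shuffle swap1s !parc_idm comp_sysA. Qed.

Lemma shuffle1r A B Z : shuffle A B U Z = idm (A \s (B \s Z)).
Proof. by rewrite /shuffle swap1 !parc_idm comp_sysA. Qed.

Lemma seqc_par_state A B A' B' f g rho sigma :
  hom U A rho -> hom U B sigma -> hom A A' f -> hom B B' g ->
  f \p g \c (rho \p sigma) = (f \c rho) \p (g \c sigma).
Proof. by move=> hr hs hf hg; apply: (interchange hr hf hs hg). Qed.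

Lemma det_pair A e rho : det A U e -> det U A rho -> e \c rho = idm U.
Proof. by move=> de dr; apply/det_scalar/(det_seqc dr de). Qed.

Variables (A B : sys T) (kappa : ev T).
Hypothesis kappa_det : det U (A \s B) kappa.
Hypothesis kappa_perp :
  forall alpha beta, St A alpha -> St B beta -> perp (A \s B) kappa (alpha \p beta).
Let kappa_hom := det_hom kappa_det.

(* Puts kappa on the first factor and on the B inserted between Y and Z. *)
Definition link Y Z sigma : ev T := shuffle A B Y Z \c (kappa \p sigma).

Lemma link_det Y Z sigma :
  det U (Y \s Z) sigma -> det U (A \s Y \s B \s Z) (link Y Z sigma).
Proof.
by move=> ds; apply: det_seqc (shuffle_det A B Y Z); apply: det_par_state.
Qed.

(** Events acting factor by factor pass through the shuffle and act on [kappa] and [sigma]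
    separately; marginals of linked states are computed this way. *)
Lemma link_nat Y Z A' B' Y' Z' f g y z sigma : St (Y \s Z) sigma ->
  hom A A' f -> hom B B' g -> hom Y Y' y -> hom Z Z' z ->
  f \p y \p g \p z \c link Y Z sigma =
  shuffle A' B' Y' Z' \c ((f \p g \c kappa) \p (y \p z \c sigma)).
Proof.
move=> hs hf hg hy hz.
have h1 := hom_par_state kappa_hom hs.
have hfg := parc_hom hf hg; have hyz := parc_hom hy hz.
have h2 : hom (A \s Y \s B \s Z) (A' \s Y' \s B' \s Z') (f \p y \p g \p z).
  exact: (parc_hom (parc_hom (parc_hom hf hy) hg) hz).
rewrite /link (seqcA h1 (shuffle_hom A B Y Z) h2) (shuffle_nat hf hg hy hz).
rewrite -(seqcA h1 (parc_hom hfg hyz) (shuffle_hom A' B' Y' Z')).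
by rewrite (seqc_par_state kappa_hom hs hfg hyz).
Qed.

(** Discarding the linked [A] and [B] recovers the original states. *)
Lemma link_perp_same Y Z rho sigma :
  det U (Y \s Z) rho -> det U (Y \s Z) sigma -> perp (Y \s Z) rho sigma ->
  perp (A \s Y \s B \s Z) (link Y Z rho) (link Y Z sigma).
Proof.
move=> dr ds p.
have [eA dA] := det_eff_exists A; have [eB dB] := det_eff_exists B.
have dF : det (A \s Y \s B \s Z) (Y \s Z) (eA \p idm Y \p eB \p idm Z).
  have := det_parc (det_parc (det_parc dA (det_idm Y)) dB) (det_idm Z).
  by rewrite comp_sys1s comp_syss1.
have E t : det U (Y \s Z) t -> eA \p idm Y \p eB \p idm Z \c link Y Z t = t.
  move=> dt; have ht := det_hom dt.
  rewrite (link_nat ht (det_hom dA) (det_hom dB) (idm_hom Y) (idm_hom Z)).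
  rewrite shuffle1l (det_pair (det_par_eff dA dB) kappa_det) parc1e parc_idm.
  by rewrite (seqc1e ht) comp_sys1s (seqc1e ht).
apply: (perp_seqc T_simplicial dF); try exact/det_hom/link_det.
by rewrite !E.
Qed.

Lemma link_perp Y V W rho sigma :
  det U (Y \s (V \s B \s W)) rho -> det U (Y \s B \s V \s W) sigma ->
  perp (A \s Y \s B \s (V \s B \s W))
    (link Y (V \s B \s W) rho) (link (Y \s B \s V) W sigma).
Proof.
move=> dr ds; have hr := det_hom dr; have hs := det_hom ds.
have [eB dB] := det_eff_exists B; have [eY dY] := det_eff_exists Y.
have [eV dV] := det_eff_exists V; have [eW dW] := det_eff_exists W.
have [[hB hY] [hV hW]] :=
  (conj (conj (det_hom dB) (det_hom dY)) (conj (det_hom dV) (det_hom dW))).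
(* [F] keeps the first [A] and the [B] linked to it in the second state. In the first state the
   partner of [A] is discarded, so the marginals are a product state and [kappa]. *)
pose F := idm A \p (eY \p eB \p eV) \p idm B \p eW.
have sysE : A \s Y \s B \s (V \s B \s W) = A \s (Y \s B \s V) \s B \s W.
  by rewrite !comp_sysA.
have dYBV := det_par_eff (det_par_eff dY dB) dV.
have dF : det (A \s (Y \s B \s V) \s B \s W) (A \s B) F.
  have := det_parc (det_parc (det_parc (det_idm A) dYBV) (det_idm B)) dW.
  by rewrite !comp_syss1.
have F1 : F \c link Y (V \s B \s W) rho =
    (idm A \p eB \c kappa) \p (eY \p (eV \p idm B \p eW) \c rho).
  have hz : hom (V \s B \s W) B (eV \p idm B \p eW).
    exact: (hom_par_effr (hom_par_effl hV (idm_hom B)) hW).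
  have -> : F = idm A \p eY \p eB \p (eV \p idm B \p eW) by rewrite /F !parcA.
  rewrite (link_nat hr (idm_hom A) hB hY hz) shuffle1l.
  have h1 := seqc_hom kappa_hom (parc_hom (idm_hom A) hB).
  have h2 := seqc_hom hr (parc_hom hY hz).
  by have := hom_par_state h1 h2; rewrite comp_syss1 => /seqc1e ->.
have F2 : F \c link (Y \s B \s V) W sigma = kappa.
  have hYBV := det_hom dYBV.
  rewrite (link_nat hs (idm_hom A) (idm_hom B) hYBV hW) shuffle1r.
  rewrite (det_pair (det_par_eff dYBV dW) ds) parce1 parc_idm (seqc1e kappa_hom).
  by rewrite comp_syss1 (seqc1e kappa_hom).
rewrite sysE; apply: (perp_seqc T_simplicial dF).
- by rewrite -sysE; apply/det_hom/link_det.
- exact/det_hom/link_det.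
rewrite F1 F2; apply/perpC/kappa_perp.
- by have := seqc_hom kappa_hom (hom_par_effr (idm_hom A) hB).
- apply: seqc_hom hr _; apply: hom_par_effl hY _.
  exact: (hom_par_effr (hom_par_effl hV (idm_hom B)) hW).
Qed.

Definition pw X n : sys T := composite (nseq n X).

Lemma composite_cons X s : composite (X :: s) = X \s composite s.
Proof. by rewrite /composite big_cons. Qed.

Lemma composite_nil : composite [::] = U :> sys T.
Proof. by rewrite /composite big_nil. Qed.

Lemma composite_cat s t : composite (s ++ t) = composite s \s composite t :> sys T.
Proof.
elim: s => [|X s IH]; first by rewrite composite_nil comp_sys1s.
by rewrite /= !composite_cons IH comp_sysA.
Qed.

Lemma pwS X n : pw X n.+1 = X \s pw X n.
Proof. exact: composite_cons. Qed.

Lemma pwD X m n : pw X (m + n) = pw X m \s pw X n.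
Proof. by rewrite /pw nseqD composite_cat. Qed.

(* The index (i, j) links the first A with the i-th B and matches the remaining
   factors according to j, so that J enumerates the perfect matchings. *)
Lemma fact_perp_states N : exists (J : finType) (t : J -> ev T),
  [/\ #|J| = N`!, forall j, det U (pw A N \s pw B N) (t j)
    & forall i j, i != j -> perp (pw A N \s pw B N) (t i) (t j)].
Proof.
elim: N => [|N [J [t [cJ dt pt]]]].
  exists unit, (fun=> idm U); split=> [|_|[] []] //; first exact: card_unit.
  by rewrite /pw composite_nil comp_sys1s; apply: det_idm.
pose Y (i : 'I_N.+1) := pw A N \s pw B i; pose Z (i : 'I_N.+1) := pw B (N - i).
have YZ i : pw A N \s pw B N = Y i \s Z i.
  by rewrite /Y /Z -comp_sysA -pwD subnKC // -ltnS.
have sE i : pw A N.+1 \s pw B N.+1 = A \s Y i \s B \s Z i.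
  rewrite /Y /Z -!comp_sysA -pwS -pwD comp_sysA -pwS.
  by rewrite addnS subnKC // -ltnS.
pose t' (x : 'I_N.+1 * J) := link (Y x.1) (Z x.1) (t x.2).
have P (i i' : 'I_N.+1) j j' : (i < i')%N ->
    perp (pw A N.+1 \s pw B N.+1) (t' (i, j)) (t' (i', j')).
  (* [V] collects the [B] factors strictly between the two partners of the first [A]. *)
  move=> ii; pose V := pw B (i' - i.+1).
  have EZ : Z i = V \s B \s Z i'.
    rewrite /Z /V -comp_sysA -pwS -pwD; congr pw.
    by have := ltn_ord i'; lia.
  have EY : Y i' = Y i \s B \s V.
    rewrite /Y /V -!comp_sysA -pwS -pwD; congr (_ \s pw _ _); lia.
  rewrite (sE i) /t' /= EZ EY; apply: link_perp.
    by rewrite -EZ -YZ.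
  by rewrite -EY -YZ.
exists ('I_N.+1 * J)%type, t'; split.
- by rewrite card_prod card_ord cJ factS.
- by move=> [i j]; rewrite (sE i); apply: link_det; rewrite -YZ.
move=> [i j] [i' j'] ne; have [lt|lt|e] := ltngtP i i'; first exact: P.
  exact/perpC/P.
have {}e : i = i' by apply: val_inj.
rewrite -{i'}e in ne *; rewrite (sE i); apply: link_perp_same; rewrite -?YZ //.
by apply: pt; apply: contraNneq ne => /= ->.
Qed.

Lemma fact_le_dim N : (N`! <= dimSt (pw A N \s pw B N))%N.
Proof.
have [J [t [<- dt pt]]] := fact_perp_states N.
exact: (perp_card T_simplicial dt pt).
Qed.

End Linking.

(** * Exponential upper bound on dimensions *)

Section Dimension.
Variables (R : realType) (T : opt R).
Local Notation U := (unit_sys T).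
Implicit Types (A B C X Y Z : sys T) (e f g r rho tau sigma : ev T).

Lemma wide_kernel (F : fieldType) d m (M : 'M[F]_(d, m)) : (m < d)%N ->
  exists2 c : 'rV_d, c != 0 & c *m M = 0.
Proof.
move=> md; have : kermx M != 0.
  rewrite kermx_eq0 /row_free neq_ltn (leq_ltn_trans _ md) //.
  exact: rank_leq_col.
by move=> /rowV0Pn [c /sub_kermxP cM c0]; exists c.
Qed.

(** Greedy choice: while fewer than [d] effects are chosen, some non-zero combination of the [v i]
    vanishes on all of them, and an effect detecting it gives a new independent row. *)
Lemma row_free_evaluations X d (v : 'I_d -> vect X) : lin_indep v ->
  exists x : 'I_d -> Eff X, row_free (\matrix_(j < d, i < d) (v i (x j) : R)).
Proof.
move=> fv; suff K p : (p <= d)%N -> exists x : 'I_p -> Eff X,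
    row_free (\matrix_(j < p, i < d) (v i (x j) : R)) by exact: K.
elim: p => [_|p IH pd].
  have x (i : 'I_0) : Eff X by case: i.
  by exists x; rewrite /row_free eqn_leq rank_leq_row.
have [x hx] := IH (ltnW pd).
pose M := \matrix_(j < p, i < d) (v i (x j) : R).
have [c c0 cM] := wide_kernel M^T pd.
have [x0 cx0] : exists x0, \sum_i c 0 i * v i x0 != 0.
  apply/not_existsP => H; move/eqP: c0; apply; apply/rowP => i; rewrite mxE.
  apply: (fv (fun i => c 0 i)); apply/funext => y; rewrite vect_sumE.
  by have /negP := H y; rewrite negbK => /eqP.
exists (fun j => if unlift ord0 j is Some k then x k else x0).
apply: inj_row_free => y yM.
have E k : \sum_j y 0 j * v k (if unlift ord0 j is Some l then x l else x0) = 0.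
  have /rowP /(_ k) := yM; rewrite !mxE => {2}<-.
  by apply: eq_bigr => j _; rewrite !mxE.
(* Pairing the relation with [c] kills the rows of the old effects and leaves the coefficient of
   [x0] times a non-zero value. *)
have y0 : y 0 ord0 = 0.
  have : \sum_k c 0 k * (\sum_j y 0 j *
      v k (if unlift ord0 j is Some l then x l else x0)) = 0.
    by rewrite big1 // => k _; rewrite E mulr0.
  under eq_bigr do rewrite mulr_sumr.
  rewrite exchange_big /= big_ord_recl unlift_none.
  under eq_bigr do rewrite mulrCA.
  rewrite -mulr_sumr [X in _ + X]big1 ?addr0; last first.
    move=> j _; rewrite liftK; under eq_bigr do rewrite mulrCA.
    rewrite -mulr_sumr (_ : \sum_i _ = 0) ?mulr0 //.
    have /rowP /(_ j) := cM; rewrite !mxE => {2}<-.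
    by apply: eq_bigr => i _; rewrite !mxE.
  by move=> /eqP; rewrite mulf_eq0 (negbTE cx0) orbF => /eqP.
have z0 : \row_j y 0 (lift ord0 j) = 0.
  apply: (row_free_inj hx); rewrite mul0mx; apply/rowP => k; rewrite !mxE -[RHS](E k).
  rewrite big_ord_recl y0 mul0r add0r; apply: eq_bigr => j _.
  by rewrite !mxE liftK.
apply/rowP => j; rewrite mxE; have [k ->|->//] := unliftP ord0 j.
by have /rowP /(_ k) := z0; rewrite !mxE.
Qed.

Lemma StR_basis X : exists2 v : 'I_(dimSt X) -> vect X, lin_indep v &
  forall w, StR X w <-> exists c, w = \sum_i c i *: v i.
Proof.
have [v [fv sv]] := dimStP X; exists v => // w; rewrite -sv; split.
  move=> [n [c [x [xr ->]]]].
  have /choice [s hs] i : exists j, v j = x i by have [j _ <-] := xr i; exists j.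
  exists (fun j => \sum_(i | s i == j) c i); rewrite -sum_reindex.
  by apply: eq_bigr => i _; rewrite hs.
by move=> [c ->]; exists (dimSt X), c, v; split=> // i; exists i.
Qed.

Lemma separating_effects X : exists x : 'I_(dimSt X) -> Eff X,
  forall v, StR X v -> (forall i, v (x i) = 0) -> v = 0.
Proof.
have [v fv sv] := StR_basis X; have [x hx] := row_free_evaluations fv.
exists x => w /sv [c ->] c0.
have z : (\row_i c i) *m (\matrix_(j, i) (v i (x j) : R))^T = 0.
  apply/rowP => j; rewrite !mxE -[RHS](c0 j) vect_sumE.
  by apply: eq_bigr => i _; rewrite !mxE.
move: hx; rewrite row_free_unit -unitmx_tr -row_free_unit => hx.
have /rowP c00 : \row_i c i = 0 by apply: (row_free_inj hx); rewrite mul0mx.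
by rewrite big1 // => i _; have := c00 i; rewrite !mxE => ->; rewrite scale0r.
Qed.

Lemma dim_le_separating X (J : finType) (x : J -> Eff X) :
  (forall v, StR X v -> (forall j, v (x j) = 0) -> v = 0) -> (dimSt X <= #|J|)%N.
Proof.
move=> sep; rewrite leqNgt; apply/negP => lt.
have [v fv sv] := StR_basis X.
have [c c0 cM] := wide_kernel (\matrix_(i < dimSt X, j < #|J|) (v i (x (enum_val j)) : R)) lt.
move/eqP: c0; apply; apply/rowP => i; rewrite mxE.
apply: (fv (fun i => c 0 i)); apply: sep; first by apply/sv; exists (fun i => c 0 i).
move=> j; rewrite vect_sumE; have /rowP /(_ (enum_rank j)) := cM.
by rewrite !mxE => {2}<-; apply: eq_bigr => k _; rewrite !mxE enum_rankK.
Qed.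

(** Precomposing with the pullback of effects along [g] is the linear extension of [g] to the span
    of the states. *)
Lemma StR_pull X Y g v (hg : hom X Y g) : StR X v ->
  StR Y (fun y => v (mkeff (seqc_hom hg (eff_hom y)))).
Proof.
move=> [n [c [w [ws ->]]]].
have /choice [t ht] i : exists t, St X t /\ svec X t = w i.
  by have [t h e] := ws i; exists t.
exists n, c, (fun i => svec Y (g \c t i)); split.
  move=> i; exists (g \c t i) => //; have [hti _] := ht i.
  exact: seqc_hom hti hg.
apply/funext => y; rewrite !vect_sumE; apply: eq_bigr => i _.
by have [hti <-] := ht i; rewrite (svec_seqc y hg hti).
Qed.

Lemma vect_congr X (v : vect X) (x y : Eff X) : val x = val y -> v x = v y.
Proof. by move=> /val_inj ->. Qed.

(** One factor is freed at a time: with the other factor fixed, [v] becomes a vector of a single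
    system, where the separating effects decide whether it vanishes. *)
Lemma product_effects_separation X Y Z r (hr : hom X (Y \s Z) r) :
  exists x : 'I_(dimSt Y) * 'I_(dimSt Z) -> Eff X,
  forall v, StR X v -> (forall i, v (x i) = 0) ->
  forall e f (hef : hom X U (e \p f \c r)),
    hom Y U e -> hom Z U f -> v (mkeff hef) = 0.
Proof.
have [y hy] := separating_effects Y; have [z hz] := separating_effects Z.
pose x (i : 'I_(dimSt Y) * 'I_(dimSt Z)) :=
  mkeff (seqc_hom hr (hom_par_eff (eff_hom (y i.1)) (eff_hom (z i.2)))).
exists x => v hv vx e f hef he hf.
have E1 g1 g2 : hom Y U g1 -> hom Z U g2 -> g1 \p g2 \c r = g1 \c ((idm Y \p g2) \c r).
  move=> h1 h2; have h := hom_par_effr (idm_hom Y) h2.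
  rewrite (seqcA hr h h1); congr (_ \c _).
  rewrite -{2}(parce1 g1) (interchange (idm_hom Y) h1 h2 (idm_hom U)).
  by rewrite (seqce1 h1) (seqc1e h2).
have E2 g1 g2 : hom Y U g1 -> hom Z U g2 -> g1 \p g2 \c r = g2 \c ((g1 \p idm Z) \c r).
  move=> h1 h2; have h := hom_par_effl h1 (idm_hom Z).
  rewrite (seqcA hr h h2); congr (_ \c _).
  rewrite -{2}(parc1e g2) (interchange h1 (idm_hom U) (idm_hom Z) h2).
  by rewrite (seqc1e h1) (seqce1 h2).
have K (j : 'I_(dimSt Z)) (g1 : ev T) (h1 : hom Y U g1) :
    v (mkeff (seqc_hom hr (hom_par_eff h1 (eff_hom (z j))))) = 0.
  have hzj := eff_hom (z j).
  have hg := seqc_hom hr (hom_par_effr (idm_hom Y) hzj).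
  have : (fun a => v (mkeff (seqc_hom hg (eff_hom a)))) = 0 :> vect Y.
    apply: hy (StR_pull hg hv) _ => i; rewrite -[RHS](vx (i, j)); apply: vect_congr => /=.
    exact: esym (E1 _ _ (eff_hom (y i)) hzj).
  move=> /(congr1 (fun w => w (mkeff h1))) /= E; rewrite -[RHS]E.
  by apply: vect_congr; rewrite /= E1.
have hg := seqc_hom hr (hom_par_effl he (idm_hom Z)).
have : (fun a => v (mkeff (seqc_hom hg (eff_hom a)))) = 0 :> vect Z.
  apply: hz (StR_pull hg hv) _ => j; rewrite -[RHS](K j e he); apply: vect_congr => /=.
  exact: esym (E2 _ _ he (eff_hom (z j))).
move=> /(congr1 (fun w => w (mkeff hf))) /= E; rewrite -[RHS]E.
by apply: vect_congr; rewrite /= E2.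
Qed.

End Dimension.

(** * Reorderings of factors and block effects *)

Section Reordering.
Variables (R : realType) (T : opt R).
Local Notation U := (unit_sys T).
Implicit Types (A B C X Y Z : sys T) (s t : seq (sys T)) (e f g r : ev T).

Lemma reorder_hom s t r : reorder s t r -> hom (composite s) (composite t) r.
Proof.
elim=> [|A s1 s2 {}t {}r _ IH]; first by rewrite composite_nil; apply: idm_hom.
rewrite composite_cat !composite_cons.
have h1 := parc_hom (swap_hom (composite s1) A) (idm_hom (composite s2)).
have h2 := parc_hom (idm_hom A) IH.
rewrite composite_cat in h2; rewrite comp_sysA.
by rewrite comp_sysA in h2; apply: seqc_hom h1 h2.
Qed.

Lemma reorder_size s t r : reorder s t r -> size t = size s.
Proof.
by elim=> // A s1 s2 {}t {}r _; rewrite !size_cat /= => ->; rewrite addnS.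
Qed.

Lemma reorder_map (W : eqType) (phi : W -> sys T) (w : seq W) t r :
  reorder (map phi w) t r -> exists2 w', t = map phi w' & perm_eq w w'.
Proof.
move e: (map phi w) => s h; elim: h w e => [|A s1 s2 {}t {}r _ IH] w e.
  by exists [::] => //; case: w e.
have := cat_take_drop (size s1) w.
have : map phi (drop (size s1) w) = A :: s2 by rewrite map_drop e drop_size_cat.
have e1 : map phi (take (size s1) w) = s1 by rewrite map_take e take_size_cat.
case: (drop _ _) => // x w2 [<- e2] <-.
have [|w' -> pw'] := IH (take (size s1) w ++ w2); first by rewrite map_cat e1 e2.
by exists (x :: w') => //; rewrite -cat1s perm_catCA /= perm_cons.
Qed.

Lemma reorder_inv s t r : reorder s t r -> (0 < size s)%N ->
  exists A s1 s2 t' r', [/\ s = s1 ++ A :: s2, t = A :: t',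
    r = (idm A \p r') \c (swap (composite s1) A \p idm (composite s2))
    & reorder (s1 ++ s2) t' r'].
Proof. by case=> // A s1 s2 t' r' h _; exists A, s1, s2, t', r'. Qed.

(** A reordering is determined by the position of the factor brought to the front and a reordering
    of the rest. The enumeration may have repetitions. *)
Lemma reorder_finite s m : size s = m -> exists q : 'I_m`! -> seq (sys T) * ev T,
  (forall i, reorder s (q i).1 (q i).2) /\
  (forall t r, reorder s t r -> exists i, q i = (t, r)).
Proof.
elim: m s => [|m IH] s hs.
  rewrite (size0nil hs); exists (fun=> ([::], idm U)); split.
    by move=> _; apply: reorder_nil.
  move=> t r h; exists ord0; move e : [::] h => s' h.
  by case: h e => // A s1 s2 t' r' _; case: s1.
have /choice [q hq] (i : 'I_m.+1) :
    exists q : 'I_m`! -> seq (sys T) * ev T,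
    (forall j, reorder (take i s ++ drop i.+1 s) (q j).1 (q j).2) /\
    (forall t r, reorder (take i s ++ drop i.+1 s) t r -> exists j, q j = (t, r)).
  apply: IH; rewrite size_cat size_take size_drop hs ltn_ord.
  by rewrite subSS subnKC // -ltnS.
pose J := ('I_m.+1 * 'I_m`!)%type.
have cJ : #|{: J}| = m.+1`! by rewrite card_prod !card_ord factS.
pose ins (x : J) := let: (i, j) := x in let A := nth U s i in
  (A :: (q i j).1, (idm A \p (q i j).2) \c
     (swap (composite (take i s)) A \p idm (composite (drop i.+1 s)))).
exists (fun k => ins (enum_val (cast_ord (esym cJ) k))); split.
  move=> k; case: (enum_val _) => i j /=.
  rewrite -{1}(cat_take_drop i s) (drop_nth U) ?hs ?ltn_ord //.
  by apply: reorder_cons; have [] := hq i.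
move=> t r /reorder_inv; rewrite hs => /(_ erefl) [A [s1 [s2 [t' [r' [sE -> -> h]]]]]].
have lt : (size s1 < m.+1)%N.
  by rewrite -hs sE size_cat /= addnS ltnS leq_addr.
have ts : take (size s1) s = s1 by rewrite sE take_size_cat.
have ds : drop (size s1).+1 s = s2.
  by rewrite sE -addn1 addnC -drop_drop drop_size_cat //= drop0.
have [_ /(_ t' r')] := hq (Ordinal lt); rewrite /= ts ds => /(_ h) [j qj].
exists (cast_ord cJ (enum_rank (Ordinal lt, j))).
rewrite cast_ordK enum_rankK /= qj /= ts ds.
by rewrite sE nth_cat ltnn subnn.
Qed.

Lemma block_eff_hom (I : Type) (js : seq I) (g : I -> seq (sys T))
    (e : I -> ev T) :
  (forall j, Eff (composite (g j)) (e j)) ->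
  hom (composite (flatten [seq g j | j <- js])) U
      (\big[@parc R T/idm U]_(j <- js) e j).
Proof.
move=> he; elim: js => [|j js IH].
  by rewrite big_nil composite_nil; apply: idm_hom.
by rewrite big_cons /= composite_cat; apply: hom_par_eff => //; apply: he.
Qed.

(** A block has at most [n] of the [n.+1] factors, so the first block is a proper part, and the
    remaining blocks together form the second effect. *)
Lemma block_product_split n s x : size s = n.+1 -> block_product n s x ->
  exists t r (i : 'I_n) e f,
    [/\ reorder s t r, hom (composite (take i.+1 t)) U e,
        hom (composite (drop i.+1 t)) U f & x = e \p f \c r].
Proof.
move=> ss [l [g [e [r [hg he hr ->]]]]]; have st := reorder_size hr.
case: l g e hg he hr st => [|l] g e hg he hr.
  by rewrite enum_ord0 ss.
rewrite enum_ordSl /= size_cat ss => st.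
have /andP[g0 gn] := hg ord0.
(* The cut falls after [i.+1] factors with [i] in ['I_n], so both sides are non-empty. *)
have lt : ((size (g ord0)).-1 < n)%N by rewrite prednK.
exists (flatten [seq g j | j <- enum 'I_l.+1]), r, (Ordinal lt), (e ord0).
exists (\big[@parc R T/idm U]_(j < l) e (lift ord0 j)); split=> //.
- by rewrite enum_ordSl /= prednK // take_size_cat //; apply: he.
- rewrite enum_ordSl /= prednK // drop_size_cat // -map_comp.
  have := block_eff_hom (enum 'I_l) (fun j => he (lift ord0 j)).
  by rewrite [index_enum _]unlock -enumT.
by rewrite big_ord_recl.
Qed.

End Reordering.

(** * Growth of dimensions under local discriminability *)

Section Growth.
Variables (R : realType) (T : opt R) (n : nat).
Hypothesis T_nlocal : nlocal_discriminability T n.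
Local Notation U := (unit_sys T).
Implicit Types (A B C X Y Z : sys T) (s t : seq (sys T)) (e f g r : ev T).

(** For each reordering and cut, as many product effects as the product of the two dimensions
    suffice. A vector vanishing on all of these vanishes on every block product, hence is null by
    local discriminability. *)
Lemma dim_le_splits s : size s = n.+1 ->
  exists q : 'I_n.+1`! -> seq (sys T) * ev T,
  (forall i, reorder s (q i).1 (q i).2) /\
  (dimSt (composite s) <= \sum_(x : 'I_n.+1`! * 'I_n)
     dimSt (composite (take x.2.+1 (q x.1).1)) *
     dimSt (composite (drop x.2.+1 (q x.1).1)))%N.
Proof.
move=> ss; have [q [hq qs]] := reorder_finite ss; exists q; split=> //.
pose D1 (x : 'I_n.+1`! * 'I_n) := dimSt (composite (take x.2.+1 (q x.1).1)).
pose D2 (x : 'I_n.+1`! * 'I_n) := dimSt (composite (drop x.2.+1 (q x.1).1)).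
have hr (x : 'I_n.+1`! * 'I_n) : hom (composite s) (composite (take x.2.+1 (q x.1).1) \s
    composite (drop x.2.+1 (q x.1).1)) (q x.1).2.
  by rewrite -composite_cat cat_take_drop; apply: reorder_hom.
pose w x := projT1 (cid (product_effects_separation (hr x))).
have hw x := projT2 (cid (product_effects_separation (hr x))).
pose J := {x : 'I_n.+1`! * 'I_n & ('I_(D1 x) * 'I_(D2 x))%type}.
have cJ : #|{: J}| = (\sum_x D1 x * D2 x)%N.
  rewrite card_tagged sumnE big_map big_enum /=.
  by apply: eq_bigr => x _; rewrite card_prod !card_ord.
pose y (j : J) := w (tag j) (tagged j).
rewrite -[X in (_ <= X)%N]cJ; refine (dim_le_separating (x := y) _) => v hv vw.
have vB x : block_product n s (val x) -> v x = 0.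
  move=> /(block_product_split ss) [t [r [i [e [f [hr' he hf xE]]]]]].
  have [k qk] := qs _ _ hr'.
  have hx : hom (composite s) U (e \p f \c (q k).2).
    by rewrite qk -xE; apply: eff_hom.
  rewrite (vect_congr v (y := mkeff hx)); last by rewrite xE /= qk.
  apply: (hw (k, i) v hv).
  - by move=> j; apply: (vw (existT _ (k, i) j)).
  - by rewrite /= qk.
  - by rewrite /= qk.
apply: (T_nlocal (s := s)) => //; first by rewrite ss.
  exists 0%N, (fun=> 0), (fun=> 0); split; first by case.
  by rewrite big_ord0.
move=> x [N [c [z [_ hz E]]]]; rewrite E // big1 // => i _.
by rewrite vB ?mulr0.
Qed.

Variables (A B : sys T).

Definition word_sys (w : seq bool) : sys T :=
  composite [seq if b then A else B | b <- w].

Lemma composite_words (S : seq (seq bool)) :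
  composite (map word_sys S) = word_sys (flatten S).
Proof.
elim: S => [|w S IH]; first by rewrite /word_sys /= !composite_nil.
by rewrite /= composite_cons IH /word_sys map_cat composite_cat.
Qed.

Lemma flatten_size_gt0 (S : seq (seq bool)) :
  [::] \notin S -> (0 < size S)%N -> (0 < size (flatten S))%N.
Proof.
by case: S => // w S; rewrite inE negb_or size_cat; case: w.
Qed.

Lemma dim_word_split w : (n < size w)%N ->
  exists w1 w2 : 'I_n.+1`! * 'I_n -> seq bool,
  (forall x, [/\ 0 < size (w1 x), 0 < size (w2 x)
               & size (w1 x) + size (w2 x) = size w]%N) /\
  (dimSt (word_sys w) <=
     \sum_x dimSt (word_sys (w1 x)) * dimSt (word_sys (w2 x)))%N.
Proof.
(* The [n.+1] pieces are the first [n] letters and the remaining word, which is non-empty. *)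
move=> nw; pose S := rcons [seq [:: b] | b <- take n w] (drop n w).
have fS : flatten S = w.
  by rewrite /S -cats1 flatten_cat /= cats0 -[X in _ = X](cat_take_drop n) flatten_seq1.
have sS : size S = n.+1 by rewrite size_rcons size_map size_takel // ltnW.
have S0 : [::] \notin S.
  rewrite mem_rcons inE negb_or; apply/andP; split.
    by rewrite eq_sym -size_eq0 size_drop subn_eq0 -ltnNge.
  by apply/negP => /mapP [].
have [|q [hq]] := dim_le_splits (s := map word_sys S); first by rewrite size_map.
rewrite composite_words fS => hD.
have /choice [S' hS'] i : exists S', (q i).1 = map word_sys S' /\ perm_eq S S'.
  by have [S' e p] := reorder_map (hq i); exists S'.
exists (fun x : 'I_n.+1`! * 'I_n => flatten (take x.2.+1 (S' x.1))).
exists (fun x : 'I_n.+1`! * 'I_n => flatten (drop x.2.+1 (S' x.1))).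
split.
  move=> [i k] /=; have [_ p] := hS' i.
  have sS' : size (S' i) = n.+1 by rewrite -(perm_size p).
  have S'0 : [::] \notin S' i by rewrite -(perm_mem p).
  split.
  - apply: flatten_size_gt0; first by apply: contra S'0 => /mem_take.
    by rewrite size_takel // sS' ltnS ltnW.
  - apply: flatten_size_gt0; first by apply: contra S'0 => /mem_drop.
    by rewrite size_drop sS' subSS subn_gt0.
  rewrite -size_cat -flatten_cat cat_take_drop -fS !size_flatten.
  by apply: perm_sumn; rewrite perm_sym; apply: perm_map.
apply: leq_trans hD _; apply: leq_sum => x _; have [-> _] := hS' x.1.
by rewrite -map_take -map_drop !composite_words.
Qed.

(* Multiplying the dimension by the number Q of splittings absorbs the sum in
   dim_word_split and makes the bound multiplicative. *)
Lemma dim_word_le_exp : (0 < n)%N -> exists K, forall w, (0 < size w)%N ->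
  (dimSt (word_sys w) <= K ^ size w)%N.
Proof.
move=> n0; pose Q := (n.+1`! * n)%N.
have Q0 : (0 < Q)%N by rewrite muln_gt0 fact_gt0.
(* The double sum dominates the dimension of every word of length at most [n]; the summand 1 makes
   [K] positive. *)
pose K := (1 + Q * \sum_(k < n.+1) \sum_(w : k.-tuple bool) dimSt (word_sys w))%N.
suff H m w : (size w < m)%N -> (0 < size w)%N ->
    (Q * dimSt (word_sys w) <= K ^ size w)%N.
  by exists K => w w0; apply: leq_trans (H _ w (leqnn _) w0); rewrite leq_pmull.
elim: m w => // m IH w; rewrite ltnS => wm w0.
have [wn|nw] := leqP (size w) n.
  apply: (@leq_trans K); last by rewrite -{1}(expn1 K) leq_pexp2l.
  rewrite /K -ltnS in wn *; apply: leq_trans (leq_addl _ _); rewrite leq_mul2l.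
  apply/orP; right; rewrite (bigD1 (Ordinal wn)) //= (bigD1 (in_tuple w)) //=.
  by rewrite -addnA leq_addr.
have [w1 [w2 [hw hD]]] := dim_word_split nw.
(* A further factor [Q] lets each half carry its own; the induction hypothesis then bounds each of
   the [Q] summands. *)
rewrite -(leq_pmul2l Q0); apply: (@leq_trans (\sum_(x : 'I_n.+1`! * 'I_n) K ^ size w)).
  apply: leq_trans (leq_mul (leqnn Q) (leq_mul (leqnn Q) hD)) _.
  rewrite !big_distrr /=; apply: leq_sum => x _; have [s1 s2 e] := hw x.
  have l1 : (size (w1 x) < m)%N by lia.
  have l2 : (size (w2 x) < m)%N by lia.
  by rewrite -e expnD mulnA mulnACA leq_mul ?IH.
by rewrite sum_nat_const card_prod !card_ord.
Qed.

End Growth.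

(** * Exhaustion of the pure states by products *)

Lemma expn_le_fact h j : (h ^ j <= (h + j)`!)%N.
Proof.
elim: j => [|j IH]; first by rewrite expn0 fact_gt0.
by rewrite addnS factS expnS leq_mul //; lia.
Qed.

Section Saturation.
Variables (R : realType) (T : opt R) (n : nat).
Hypotheses (n_gt0 : (0 < n)%N) (T_simplicial : simplicial T)
  (T_nlocal : nlocal_discriminability T n).
Local Notation U := (unit_sys T).

Lemma no_perp_to_products (A B : sys T) kappa : det U (A \s B) kappa ->
  ~ (forall alpha beta, St A alpha -> St B beta ->
       perp (A \s B) kappa (alpha \p beta)).
Proof.
move=> dk pk; have [K hK] := dim_word_le_exp T_nlocal A B n_gt0.
(* With [h + h] copies each of [A] and [B] the word has length [4 * h], so its dimension is at most
   the [h]-th power of [K ^ 4], which is below [h ^ h] and hence below the factorial of [h + h]. *)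
pose h := (K ^ 4).+1.
have := hK (nseq (h + h) true ++ nseq (h + h) false); rewrite size_cat !size_nseq.
move=> /(_ isT); rewrite /word_sys map_cat !map_nseq composite_cat.
apply/negP; rewrite -ltnNge.
apply: leq_trans (fact_le_dim T_simplicial dk pk (h + h)).
apply: leq_trans (expn_le_fact h h).
rewrite (_ : h + h + (h + h) = 4 * h)%N; last by lia.
by rewrite expnM ltn_exp2r.
Qed.

(** Decomposing [alpha], then [beta], into extremal states moves an occurrence in any product state
    to one in some [a i \p b j]; without one, [u k] would be disjoint from all products. *)
Lemma ext_occurs_product (A B : sys T) (a : 'I_(dimSt A) -> ev T)
    (b : 'I_(dimSt B) -> ev T) (u : 'I_(dimSt (A \s B)) -> ev T) k :
  ext_enum a -> ext_enum b -> ext_enum u ->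
  exists i j, occurs (A \s B) (a i \p b j) (u k).
Proof.
move=> ha hb hu; apply/not_existsP => H.
apply: (no_perp_to_products (ext_det T_simplicial k hu)) => alpha beta hA hB tau ht.
rewrite {tau ht}(occurs_ext T_simplicial hu ht).
have split1 rho sigma : St A rho -> St B sigma ->
    (idm A \p sigma) \c rho = rho \p sigma.
  move=> hr hs; rewrite -{1}(parce1 rho).
  by rewrite (interchange hr (idm_hom A) (idm_hom U) hs) (seqc1e hr) (seqce1 hs).
have split2 rho sigma : St A rho -> St B sigma ->
    (rho \p idm B) \c sigma = rho \p sigma.
  move=> hr hs; rewrite -{1}(parc1e sigma).
  by rewrite (interchange (idm_hom U) hr hs (idm_hom B)) (seqc1e hs) (seqce1 hr).
have h1 : hom A (A \s B) (idm A \p beta).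
  by have := parc_hom (idm_hom A) hB; rewrite comp_syss1.
rewrite -(split1 _ _ hA hB) => /(occurs_seqc T_simplicial ha h1 hA) [i].
have hi := ha.1 i; rewrite (split1 _ _ hi hB) -(split2 _ _ hi hB).
have h2 : hom B (A \s B) (a i \p idm B).
  by have := parc_hom hi (idm_hom B); rewrite comp_sys1s.
move=> /(occurs_seqc T_simplicial hb h2 hB) [j].
by rewrite (split2 _ _ hi (hb.1 j)) => occ; apply: (H i); exists j.
Qed.

(** Discarding [B] sends [a i \p b j] to [a i], whose support is itself alone; the marginal of [tau]
    has a vertex lying in both such supports. Discarding [A] settles [j]. *)
Lemma occurs_product_unique (A B : sys T) (a : 'I_(dimSt A) -> ev T)
    (b : 'I_(dimSt B) -> ev T) tau i j i' j' : ext_enum a -> ext_enum b ->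
  occurs (A \s B) (a i \p b j) tau -> occurs (A \s B) (a i' \p b j') tau ->
  i = i' /\ j = j'.
Proof.
move=> ha hb o o'.
have da k := ext_det T_simplicial k ha; have db k := ext_det T_simplicial k hb.
have dt := occurs_det T_simplicial o.
have aI := ext_enum_inj ha; have bI := ext_enum_inj hb.
have [eA dA] := det_eff_exists A; have [eB dB] := det_eff_exists B.
have hAB k l := hom_par_state (det_hom (da k)) (det_hom (db l)).
split.
  have h1 : det (A \s B) A (idm A \p eB).
    by have := det_parc (det_idm A) dB; rewrite comp_syss1.
  have E k l : idm A \p eB \c (a k \p b l) = a k.
    rewrite (seqc_par_state (det_hom (da k)) (det_hom (db l)) (idm_hom A) (det_hom dB)).
    by rewrite (det_pair dB (db l)) parce1 (seqc1e (det_hom (da k))).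
  have [om hom_] := occurs_exists T_simplicial (det_seqc dt h1).
  have := occurs_map T_simplicial (det_hom h1) (hAB i j) o hom_.
  have := occurs_map T_simplicial (det_hom h1) (hAB i' j') o' hom_.
  rewrite !E => /(occurs_ext T_simplicial ha) -> /(occurs_ext T_simplicial ha).
  by move/aI.
have h1 : det (A \s B) B (eA \p idm B).
  by have := det_parc dA (det_idm B); rewrite comp_sys1s.
have E k l : eA \p idm B \c (a k \p b l) = b l.
  rewrite (seqc_par_state (det_hom (da k)) (det_hom (db l)) (det_hom dA) (idm_hom B)).
  by rewrite (det_pair dA (da k)) parc1e (seqc1e (det_hom (db l))).
have [om hom_] := occurs_exists T_simplicial (det_seqc dt h1).
have := occurs_map T_simplicial (det_hom h1) (hAB i j) o hom_.
have := occurs_map T_simplicial (det_hom h1) (hAB i' j') o' hom_.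
rewrite !E => /(occurs_ext T_simplicial hb) -> /(occurs_ext T_simplicial hb).
by move/bI.
Qed.

End Saturation.

(** * Classification of composite states *)

Lemma inj_surj_bijective (I J : Type) (f : I -> J) :
  injective f -> (forall y, exists x, f x = y) -> bijective f.
Proof.
by move=> fI /choice [g gK]; exists g => // x; apply: fI; rewrite gK.
Qed.

(** The index sets are the supports of the [a i \p b j], with coordinates as probabilities. These
    supports partition the non-null vertices, and linear independence makes the weights unique. *)
Theorem theorem4 (R : realType) (T : opt R) (n : nat) (n_gt0 : (0 < n)%N)
    (T_simplicial : simplicial T) (T_nlocal : nlocal_discriminability T n)
    (A B : sys T)
    (a : 'I_(dimSt A) -> ev T) (b : 'I_(dimSt B) -> ev T)
    (a_enum : ext_enum a) (b_enum : ext_enum b) :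
  exists (I : 'I_(dimSt A) -> 'I_(dimSt B) -> finType)
         (lab : forall i j, I i j -> ev T) (p : forall i j, I i j -> R),
    [/\ labeling a b lab p,
        dimSt (comp_sys A B) = (\sum_i \sum_j #|I i j|)%N,
        ConvSt (comp_sys A B) =
          conv_hull [set v | v = 0 \/
                             exists i j k, v = svec (comp_sys A B) (lab i j k)]
      & forall (I' : 'I_(dimSt A) -> 'I_(dimSt B) -> finType)
               (lab' : forall i j, I' i j -> ev T)
               (p' : forall i j, I' i j -> R),
          labeling a b lab' p' ->
          forall i j, exists f : I i j -> I' i j, bijective f /\
            forall k, lab' i j (f k) = lab i j k /\ p' i j (f k) = p i j k].
Proof.
have [u hu] := ext_enum_exists T_simplicial (comp_sys A B).
have uI := ext_enum_inj hu; have [u1 [u2 _ u3]] := hu.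
have dab i j : det (unit_sys T) (comp_sys A B) (parc (a i) (b j)).
  by apply: det_par_state; apply: ext_det.
have /choice [c hc] (x : 'I_(dimSt A) * 'I_(dimSt B)) :
    exists c, coords u (svec (comp_sys A B) (parc (a x.1) (b x.2))) c.
  exact: (coords_exist T_simplicial hu (det_hom (dab x.1 x.2))).
have c0 x k : 0 <= c x k by have [] := hc x.
have c1 i j : \sum_k c (i, j) k = 1.
  exact: (coords_det T_simplicial hu (hc (i, j)) (dab i j)).
pose S i j := [set k | 0 < c (i, j) k]%SET.
have occ i j k : occurs (comp_sys A B) (parc (a i) (b j)) (u k) <-> k \in S i j.
  rewrite inE; split; last first.
    by move=> h; exists u, (c (i, j)), k; split=> //; exact: hc (i, j).
  by move=> /(occursP T_simplicial _ hu (hc (i, j))) [k' /uI ->].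
have S_unique i j i' j' k : k \in S i j -> k \in S i' j' -> i = i' /\ j = j'.
  move=> /occ h /occ h'.
  exact: (occurs_product_unique T_simplicial a_enum b_enum h h').
have S_cover k : exists i j, k \in S i j.
  have [i [j /occ h]] :=
    ext_occurs_product n_gt0 T_simplicial T_nlocal k a_enum b_enum hu.
  by exists i, j.
have pureP rho : pure (comp_sys A B) rho <-> exists k, u k = rho.
  split=> [[hr er dr]|[k <-]]; last first.
    split; [exact: u1 | by have [] := u2 k I | exact: ext_det].
  have [|k _ e] := u3 (svec (comp_sys A B) rho); last first.
    by exists k; apply: svec_inj e => //; apply: u1.
  (* A deterministic state is not null: a deterministic effect takes the value 1 on it. *)
  split=> //= r0; have [e de] := det_eff_exists (comp_sys A B).
  have := (det_stateP hr).1 dr e de.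
  have /= := congr1 (fun w => w (mkeff (det_hom de))) r0.
  by rewrite /svec /= => -> /eqP; rewrite eq_sym oner_eq0.
pose I i j : finType := {k | k \in S i j}.
pose lab i j (k : I i j) := u (val k).
pose p i j (k : I i j) := c (i, j) (val k).
have sum_I (V : nmodType) i j (F : 'I_(dimSt (comp_sys A B)) -> V) :
    (forall k, c (i, j) k = 0 -> F k = 0) ->
    \sum_(k : I i j) F (val k) = \sum_k F k.
  move=> F0; rewrite -big_sub [RHS](bigID [in S i j]) /= [X in _ = _ + X]big1 ?addr0 //.
  by move=> k; rewrite inE -leNgt => ck; apply: F0; apply/eqP; rewrite eq_le ck c0.
exists I, lab, p; split.
- split.
  + split.
    * by move=> x _; apply/pureP; exists (val (tagged x)).
    * move=> [[i j] [k hk]] [[i' j'] [k' hk']] _ _ /uI /= kk.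
      rewrite -{k'}kk in hk' *.
      have /= [ii jj] := S_unique _ _ _ _ _ hk hk'; subst i' j'.
      by rewrite (bool_irrelevance hk hk').
    * move=> rho /pureP [k <-]; have [i [j hk]] := S_cover k.
      by exists (existT _ (i, j) (exist _ k hk)).
  + by move=> i j [k hk]; rewrite /p /=; rewrite inE in hk.
  + by move=> i j; rewrite -[RHS](c1 i j); apply: sum_I.
  + move=> i j; have [_ _ ->] := hc (i, j).
    rewrite -(sum_I _ i j) // => k ->; exact: scale0r.
(* Double counting: each vertex lies in exactly one [S i j]. *)
- under [RHS]eq_bigr => i _ do under eq_bigr => j _ do
    rewrite card_sig -sum1_card big_mkcond.
  rewrite pair_big exchange_big /= -[LHS]card_ord -sum1_card.
  apply: eq_bigr => k _; have [i [j hk]] := S_cover k.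
  rewrite (bigD1 (i, j)) //= hk big1 // => -[i' j'] /= ne.
  case: ifP => // hk'; have [ii jj] := S_unique _ _ _ _ _ hk hk'.
  by move: ne; rewrite ii jj eqxx.
- have [v [_ rv <-]] := T_simplicial (comp_sys A B); rewrite rv; congr conv_hull.
  apply/seteqP; split=> w.
    move=> Ew; have [->|w0] := pselect (w = 0); first by left.
    have [//|k _ <-] := u3 w; have [i [j hk]] := S_cover k.
    by right; exists i, j, (exist _ k hk).
  move=> [->|[i [j [k ->]]]]; first exact: null_ext.
  by have [] := u2 (val k) Logic.I.
move=> I' lab' p' [bij' gt' sum' dec'] i j; have [lab1 lab2 _] := bij'.
have /choice [m hm] (k : I' i j) : exists m, u m = lab' i j k.
  exact/pureP/(lab1 (existT _ (i, j) k)).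
have labI : injective (lab' i j).
  move=> k k' e.
  have := lab2 (existT _ (i, j) k) (existT _ (i, j) k'); rewrite !inE.
  by move=> /(_ Logic.I Logic.I e) /eqP; rewrite eq_Tagged /= => /eqP.
have mI : injective m by move=> k k' e; apply: labI; rewrite -!hm e.
(* [m] locates the competing labels among the vertices; uniqueness of coordinates identifies their
   weights. *)
have cE l : c (i, j) l = \sum_(k | m k == l) p' i j k.
  apply: (lin_indep_inj (ext_enum_free T_simplicial hu)
            (d := fun l => \sum_(k | m k == l) p' i j k)).
  have [_ _ <-] := hc (i, j); rewrite dec' -sum_reindex.
  by apply: eq_bigr => k _; rewrite hm.
have cm k : c (i, j) (m k) = p' i j k.
  by rewrite cE (big_pred1 k) // => k'; rewrite (inj_eq mI).
(* A vertex of positive weight is hit by [m], since otherwise its weight would be an empty sum. *)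
have /choice [f hf] (k : I i j) : exists k', m k' = val k.
  apply: contrapT => /forallNP H; have := valP k; rewrite inE.
  by rewrite cE big_pred0 ?ltxx // => k'; apply/eqP/H.
exists f; split; last by move=> k; rewrite -hm -cm hf.
apply: inj_surj_bijective => [k k' e|k'].
  by apply: val_inj; rewrite -!hf e.
have hk : m k' \in S i j by rewrite inE cm.
by exists (exist _ (m k') hk); apply: mI; rewrite hf.
Qed.
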